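(* Let $\mu \in \mathscr{W}(\mathbb{R}^n)$ with distribution function $f$, and let $U \subset \mathbb{R}^n$ be open. Let $g_k \in BV_{\mu}(U)$ be a sequence that satisfies the following two conditions. (1) $\sup_k \|g_k\|_{\infty}< \infty$. (2) There exists a function $g \in L^1_{\mathrm{loc}}(\mu, U)$ such that $g_k \rightarrow g$ in $L^1_{\mathrm{loc}}(\mu, U)$. Then $\|Dg\|(U) \le \liminf_{k \rightarrow \infty}\|Dg_k\|(U)$.
   Context: $\mathscr{W}(\mathbb{R}^n)$ is the class of measures $\mu=f\mathcal{L}^n$ whose distribution function (density) $f$ is non-negative and in $L^1(\mathbb{R}^n)\cap W^{1,1}_{\mathrm{loc}}(\mathbb{R}^n)$; $f$ is always taken to be its precise representative. $L^1(\mu,U)$ is the $L^1$ space on $U$ with respect to $\mu$, and $L^1_{\mathrm{loc}}(\mu,U)$ its local version; $\|\cdot\|_\infty$ is the $L^\infty$-norm with respect to Lebesgue measure. For a function $g$ and open $U$, $$\|g\|_{BV_\mu(U)}:=\sup\left\{\int_{U}g\big(\operatorname{div}(\phi)f+\phi\cdot\nabla f\big)\,dx:\ \phi\in C^1_c(U;\mathbb{R}^n),\ \|\phi\|_\infty\le 1\right\}\in[0,\infty],$$ and $g\in BV_\mu(U)$ iff this quantity is finite. $\|Dg\|(U)$ denotes $\|g\|_{BV_\mu(U)}$ (when finite, it is the total mass on $U$ of the variation measure $\|Dg\|_\mu$ of $g$). *)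

(* Defs.v *)
From HB Require Import structures.
From mathcomp Require Import all_boot all_order all_algebra.
From mathcomp Require Import all_classical all_reals all_analysis.

Set Implicit Arguments.
Unset Strict Implicit.
Unset Printing Implicit Defensive.

Import Order.TTheory GRing.Theory Num.Theory.
Import numFieldNormedType.Exports.

Local Open Scope classical_set_scope.
Local Open Scope ring_scope.

(* The Borel sigma-algebra of R^n, represented as 'rV[R]_n: it is generated by
   the n coordinate functions. *)
Section borel_rV.
Context {R : realType} (n : nat).

Let coords : 'I_n -> 'rV[R]_n -> measurableTypeR R := fun i x => x ord0 i.

Let rV_set0 : g_sigma_preimage coords set0.
Proof. exact: sigma_algebra0. Qed.

Let rV_setC A : g_sigma_preimage coords A -> g_sigma_preimage coords (~` A).
Proof. exact: sigma_algebraC. Qed.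

Let rV_bigcup (F : _^nat) : (forall i, g_sigma_preimage coords (F i)) ->
  g_sigma_preimage coords (\bigcup_i (F i)).
Proof. exact: sigma_algebra_bigcup. Qed.

HB.instance Definition _ := @isMeasurable.Build default_measure_display
  'rV[R]_n (g_sigma_preimage coords) rV_set0 rV_setC rV_bigcup.

End borel_rV.

Lemma measurable_coord {R : realType} n (i : 'I_n) :
  measurable_fun [set: 'rV[R]_n] (fun x => x ord0 i : measurableTypeR R).
Proof.
move=> _ Y mY; rewrite setTI; apply: sub_sigma_algebra => /=.
rewrite -bigcup_seq/=; exists i => /=; first by rewrite mem_index_enum.
by exists Y => //; rewrite setTI.
Qed.

Lemma measurable_fun_rVP {R : realType} d (T : measurableType d) n
    (f : T -> 'rV[R]_n) :
  measurable_fun setT f <->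
  forall i, measurable_fun setT (fun x => f x ord0 i : measurableTypeR R).
Proof.
split=> [mf i|mf].
  exact: (measurableT_comp (measurable_coord i) mf).
apply: (@measurability _ _ _ _ _ _ (\big[setU/set0]_(i < n)
  preimage_set_system setT (fun x : 'rV[R]_n => x ord0 i : measurableTypeR R)
    measurable)) => //.
move=> _ [B + <-].
rewrite -bigcup_seq/= => -[i /= _ [A mA <-]].
rewrite !setTI.
by have := mf i measurableT A mA; rewrite setTI.
Qed.

Section rV_cons.
Context {R : realType} (n : nat).

Definition rV_cons (p : measurableTypeR R * 'rV[R]_n) : 'rV[R]_n.+1 :=
  \row_i oapp (p.2 ord0) p.1 (unlift ord0 i).

Definition rV_uncons (x : 'rV[R]_n.+1) : measurableTypeR R * 'rV[R]_n :=
  (x ord0 ord0, \row_i x ord0 (lift ord0 i)).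

Lemma rV_cons0 p : rV_cons p ord0 ord0 = p.1.
Proof. by rewrite mxE unlift_none. Qed.

Lemma rV_consS p i : rV_cons p ord0 (lift ord0 i) = p.2 ord0 i.
Proof. by rewrite mxE liftK. Qed.

Lemma rV_consK : cancel rV_cons rV_uncons.
Proof.
move=> [a v]; congr (_, _); first by rewrite rV_cons0.
by apply/rowP => i; rewrite mxE rV_consS.
Qed.

Lemma rV_unconsK : cancel rV_uncons rV_cons.
Proof.
move=> x; apply/rowP => i; case: (unliftP ord0 i) => [j ->|->].
  by rewrite rV_consS mxE.
by rewrite rV_cons0.
Qed.

Lemma measurable_rV_cons :
  measurable_fun [set: measurableTypeR R * 'rV[R]_n] rV_cons.
Proof.
apply/measurable_fun_rVP => i; case: (unliftP ord0 i) => [j ->|->].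
  under eq_fun do rewrite rV_consS.
  exact: (measurableT_comp (measurable_coord j) measurable_snd).
under eq_fun do rewrite rV_cons0.
exact: measurable_fst.
Qed.

Lemma measurable_rV_uncons : measurable_fun [set: 'rV[R]_n.+1] rV_uncons.
Proof.
apply: measurable_fun_pair; first exact: measurable_coord.
apply/measurable_fun_rVP => i; under eq_fun do rewrite mxE.
exact: measurable_coord.
Qed.

End rV_cons.


Section lebesgue_rV_step.
Context {R : realType} (n : nat).
Variable m : {sigma_finite_measure set 'rV[R]_n -> \bar R}.

Definition lebesgue_rV_step : set 'rV[R]_n.+1 -> \bar R :=
  pushforward (@lebesgue_measure R \x m)%E (@rV_cons R n).

Let step0 : lebesgue_rV_step set0 = 0%E.
Proof. by rewrite /lebesgue_rV_step/pushforward preimage_set0 measure0. Qed.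

Let step_ge0 A : (0 <= lebesgue_rV_step A)%E.
Proof. by rewrite /lebesgue_rV_step/pushforward measure_ge0. Qed.

Let step_sigma_additive : semi_sigma_additive lebesgue_rV_step.
Proof.
exact: (@measure_semi_sigma_additive _ _ _
  (measure_function_pushforward__canonical__measure_function_Measure
     (@lebesgue_measure R \x m)%E (@measurable_rV_cons R n))).
Qed.

HB.instance Definition _ := isMeasure.Build _ _ _ lebesgue_rV_step
  step0 step_ge0 step_sigma_additive.

Let step_sigma_finite : sigma_finite setT lebesgue_rV_step.
Proof.
have /sigma_finiteP[F [FT ndF Foo]] := sigma_finiteT (@lebesgue_measure R).
have /sigma_finiteP[G [GT ndG Goo]] := sigma_finiteT m.
exists (fun k => @rV_uncons R n @^-1` (F k `*` G k)).
  rewrite -preimage_bigcup (_ : \bigcup_k (F k `*` G k) = setT) ?preimage_setT//.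
  apply/seteqP; split=> // -[x y] _.
  have [i _ Fix] : (\bigcup_k F k) x by rewrite -FT.
  have [j _ Gjy] : (\bigcup_k G k) y by rewrite -GT.
  exists (maxn i j) => //; split => /=.
    by move: x Fix; exact/subsetPset/ndF/leq_maxl.
  by move: y Gjy; exact/subsetPset/ndG/leq_maxr.
move=> k; have [mF Fk] := Foo k; have [mG Gk] := Goo k; split.
  rewrite -[X in measurable X]setTI; apply: measurable_rV_uncons => //.
  exact: measurableX.
rewrite /lebesgue_rV_step /pushforward -comp_preimage.
rewrite (_ : _ \o _ = id) ?preimage_id; last by apply/funext => p; exact: rV_consK.
by rewrite product_measure1E// lte_mul_pinfty// ge0_fin_numE.
Qed.

HB.instance Definition _ := Measure_isSigmaFinite.Build _ _ _ lebesgue_rV_step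
  step_sigma_finite.

End lebesgue_rV_step.

(* The n-fold product of the one-dimensional Lebesgue measure. *)
Fixpoint lebesgue_rV_borel {R : realType} (n : nat) :
    {sigma_finite_measure set 'rV[R]_n -> \bar R} :=
  match n with
  | 0 => \d_ (0 : 'rV[R]_0)
  | n'.+1 => lebesgue_rV_step (lebesgue_rV_borel n')
  end.

Lemma lebesgue_rV_borelS {R : realType} n (A : set R) (B : set 'rV[R]_n) :
  measurable A -> measurable B ->
  lebesgue_rV_borel n.+1 [set x | A (rV_uncons x).1 /\ B (rV_uncons x).2] =
  (@lebesgue_measure R A * lebesgue_rV_borel n B)%E.
Proof.
move=> mA mB; rewrite -product_measure1E//=.
rewrite /lebesgue_rV_step /pushforward; congr (_ _).
by apply/funext => p; rewrite /preimage/mkset -[_ /\ _]/((A `*` B) (rV_uncons (rV_cons p))) rV_consK.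
Qed.

Lemma measurable_rV_box {R : realType} n (A : 'I_n -> set R) :
  (forall i, measurable (A i)) ->
  measurable [set x : 'rV[R]_n | forall i, A i (x ord0 i)].
Proof.
move=> mA.
rewrite (_ : [set x | _] =
    \bigcap_(i in [set: 'I_n]) (fun x : 'rV[R]_n => x ord0 i) @^-1` A i).
  apply: fin_bigcap_measurable => // i _.
  by rewrite -[X in measurable X]setTI; apply: measurable_coord; [exact: measurableT|exact: mA].
by apply/seteqP; split=> x /= xA i; [move=> _; exact: xA|exact: xA].
Qed.

Lemma lebesgue_rV_borel_box {R : realType} n (a b : 'I_n -> R) :
  (forall i, a i <= b i) ->
  lebesgue_rV_borel n [set x | forall i, `[a i, b i]%classic (x ord0 i)] =
  (\prod_i (b i - a i))%:E.
Proof.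
elim: n a b => [a b _|n ih a b ab].
  rewrite big_ord0 /= diracE mem_set//=.
  by case.
pose B := [set y : 'rV[R]_n |
  forall i, `[a (lift ord0 i), b (lift ord0 i)]%classic (y ord0 i)].
transitivity (lebesgue_rV_borel n.+1
    [set x | `[a ord0, b ord0]%classic (rV_uncons x).1 /\ B (rV_uncons x).2]).
  congr (_ _); apply/seteqP; split=> x /=.
    by move=> xab; split=> [|i]; [exact: xab|rewrite mxE; exact: xab].
  move=> [x0 xS] i; case: (unliftP ord0 i) => [j ->|->//].
  by have := xS j; rewrite mxE.
have mB : measurable B.
  by apply: (@measurable_rV_box R n
    (fun i => `[a (lift ord0 i), b (lift ord0 i)]%classic)).
rewrite lebesgue_rV_borelS//.
rewrite ih// lebesgue_measure_itv/= lte_fin big_ord_recl EFinM.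
have := ab ord0; rewrite le_eqVlt => /predU1P[->|->//].
by rewrite ltxx subrr.
Qed.

(* R^n equipped with its Lebesgue sigma-algebra: the sets that are
   Caratheodory-measurable for the outer measure induced by
   [lebesgue_rV_borel]. As a bare type it is convertible to 'rV[R]_n. *)
Definition lebesgue_rV_type (R : realType) (n : nat) :=
  caratheodory_type ((@lebesgue_rV_borel R n)^*)%mu.
HB.instance Definition _ R n := Measurable.on (lebesgue_rV_type R n).

Definition lebesgue_rV {R : realType} {n : nat} :
    set (lebesgue_rV_type R n) -> \bar R :=
  @completed_measure_extension _ _ _ (lebesgue_rV_borel n).
HB.instance Definition _ R n := Measure.on (@lebesgue_rV R n).

Lemma lebesgue_rV_sigma_finite {R : realType} n :
  sigma_finite setT (@lebesgue_rV R n).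
Proof. exact/completed_measure_extension_sigma_finite/sigma_finiteT. Qed.

HB.instance Definition _ R n := @Measure_isSigmaFinite.Build _ _ _
  (@lebesgue_rV R n) (@lebesgue_rV_sigma_finite R n).

Lemma lebesgue_rV_borelE {R : realType} n (A : set 'rV[R]_n) :
  measurable A -> lebesgue_rV A = lebesgue_rV_borel n A.
Proof. exact: measurable_mu_extE. Qed.

Lemma lebesgue_rV_box {R : realType} n (a b : 'I_n -> R) :
  (forall i, a i <= b i) ->
  lebesgue_rV [set x : 'rV[R]_n | forall i, `[a i, b i]%classic (x ord0 i)] =
  (\prod_i (b i - a i))%:E.
Proof.
move=> ab; rewrite -lebesgue_rV_borel_box// lebesgue_rV_borelE//.
exact: (@measurable_rV_box R n (fun i => `[a i, b i]%classic)).
Qed.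

(* The canonical norm of 'rV[R]_n is the sup norm, hence the explicit Euclidean
   structure. *)
Definition dotrV {R : realType} {n : nat} (u v : 'rV[R]_n) : R :=
  \sum_i u ord0 i * v ord0 i.

Definition norm2 {R : realType} {n : nat} (u : 'rV[R]_n) : R :=
  Num.sqrt (dotrV u u).

Definition C1 {R : realType} {n : nat} {V : normedModType R}
    (phi : 'rV[R]_n -> V) :=
  (forall x, differentiable phi x) /\ (forall v, continuous ('D_v phi)).

(* C^1_c(U; V), the functions being extended by 0 outside U. *)
Definition C1c {R : realType} {n : nat} {V : normedModType R}
    (U : set 'rV[R]_n) (phi : 'rV[R]_n -> V) :=
  let supp := closure [set x | phi x != 0] in
  [/\ C1 phi, compact supp & supp `<=` U].

Definition divergence {R : realType} {n : nat} (phi : 'rV[R]_n -> 'rV[R]_n)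
    (x : 'rV[R]_n) : R :=
  \sum_i ('D_(delta_mx ord0 i) phi x) ord0 i.

Definition L1loc {R : realType} {n : nat}
    (mu : set (lebesgue_rV_type R n) -> \bar R) (U : set 'rV[R]_n)
    (g : 'rV[R]_n -> R) :=
  forall K, compact K -> K `<=` U -> mu.-integrable K (EFin \o g).

Definition L1loc_cvg {R : realType} {n : nat}
    (mu : set (lebesgue_rV_type R n) -> \bar R) (U : set 'rV[R]_n)
    (g_ : nat -> 'rV[R]_n -> R) (g : 'rV[R]_n -> R) :=
  forall K, compact K -> K `<=` U ->
    (\int[mu]_(x in K) `|g_ k x - g x|%:E)%E @[k --> \oo] --> 0%E.

(* Test functions of class C^1_c, as in Evans and Gariepy; testing against
   smooth functions only gives the same notion. *)
Definition is_weak_grad {R : realType} {n : nat} (f : 'rV[R]_n -> R)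
    (Df : 'rV[R]_n -> 'rV[R]_n) :=
  forall i : 'I_n,
    L1loc lebesgue_rV setT (fun x => Df x ord0 i) /\
    forall phi : 'rV[R]_n -> R, C1c setT phi ->
      \int[lebesgue_rV]_x (f x * 'D_(delta_mx ord0 i) phi x) =
      - \int[lebesgue_rV]_x (Df x ord0 i * phi x).

Definition W11loc {R : realType} {n : nat} (f : 'rV[R]_n -> R) :=
  L1loc lebesgue_rV setT f /\ exists Df, is_weak_grad f Df.

(* Meaningful only up to Lebesgue-null sets, and only when a weak gradient
   exists, e.g. when [W11loc f]. *)
Definition weak_grad {R : realType} {n : nat} (f : 'rV[R]_n -> R) :
    'rV[R]_n -> 'rV[R]_n :=
  xget (fun=> 0) (is_weak_grad f).

(* The limit of the averages over shrinking Euclidean balls where that limit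
   exists, and 0 elsewhere. *)
Definition precise_representative {R : realType} {n : nat}
    (f : 'rV[R]_n -> R) (x : 'rV[R]_n) : R :=
  let B (r : R) := [set y : 'rV[R]_n | norm2 (y - x) <= r] in
  let avg (r : R) :=
    (\int[lebesgue_rV]_(y in B r) f y) / fine (lebesgue_rV (B r)) in
  if `[< cvg (avg r @[r --> 0^'+]) >] then lim (avg r @[r --> 0^'+]) else 0.

(* [mu = f L^n] belongs to W(R^n), with distribution function f. *)
Definition scrW {R : realType} {n : nat}
    (mu : {measure set (lebesgue_rV_type R n) -> \bar R})
    (f : 'rV[R]_n -> R) :=
  [/\ forall A, measurable A -> mu A = (\int[lebesgue_rV]_(x in A) (f x)%:E)%E,
      forall x, 0 <= f x,
      lebesgue_rV.-integrable setT (EFin \o f),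
      W11loc f &
      f = precise_representative f].

(* ||g||_{BV_mu(U)} for mu = f L^n, also written ||Dg||(U). *)
Definition BVnorm {R : realType} {n : nat} (f : 'rV[R]_n -> R)
    (U : set 'rV[R]_n) (g : 'rV[R]_n -> R) : \bar R :=
  ereal_sup [set (\int[lebesgue_rV]_(x in U)
      (g x * (divergence phi x * f x + dotrV (phi x) (weak_grad f x)))%:E)%E
    | phi in [set phi : 'rV[R]_n -> 'rV[R]_n | C1c U phi /\
        ('N[lebesgue_rV]_+oo[EFin \o (norm2 \o phi)] <= 1)%E]].

Definition BV {R : realType} {n : nat} (f : 'rV[R]_n -> R)
    (U : set 'rV[R]_n) (g : 'rV[R]_n -> R) :=
  @measurable_fun _ _ (lebesgue_rV_type R n) R U g /\
  (BVnorm f U g < +oo)%E.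

(* The L^oo(U) norm with respect to Lebesgue measure ([\_] extends by 0). *)
Definition Linfty_norm {R : realType} {n : nat} (U : set 'rV[R]_n)
    (g : 'rV[R]_n -> R) : \bar R :=
  'N[lebesgue_rV]_+oo[EFin \o (g \_ U)]%E.

(* Main.v *)
Require Import Defs.
From HB Require Import structures.
From mathcomp Require Import all_boot all_order all_algebra.
From mathcomp Require Import all_classical all_reals all_analysis.
From mathcomp Require Import measurable_realfun ess_sup_inf ring lra.

Import Order.TTheory GRing.Theory Num.Theory.
Import numFieldNormedType.Exports.

(** The variation is a supremum, over test fields phi, of the integrals of g against the density
E = div phi f + phi . grad f, so lower semicontinuity follows once each of these integrals
passes to the limit: each integral for g is then the limit of the integrals for g_k, which are
bounded by the variations of g_k.

The support K of phi is compact and E is integrable on it.  The hypothesis gives convergence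
of g_k to g in L^1(K) for the weight f, not for the weight |E|: the term with grad f is not
bounded by a multiple of f.  Two facts repair this.

- The functions g_k are uniformly bounded by some M, hence so is g almost everywhere where f > 0
  (clip_dist_le and the proof of the theorem).  One can therefore truncate everything at M.

- The density E vanishes almost everywhere on the set where f = 0.  Hence E is absolutely
  continuous with respect to f on K, and convergence of bounded functions for the weight f
  implies convergence for the weight |E| (weighted_small, cvg_integral_bounded_weight).

The second fact rests on the classical theorem that the weak gradient of f vanishes almost
everywhere where f does (weak_grad_zero_set).  As f is nonnegative, there is a short proof.
Heuristically, at a zero of f the difference quotient of f in a direction v is
nonnegative, and so is the one in the direction -v, so the derivative is 0.  To make
this rigorous for weak derivatives, let A be a bounded part of the zero set, and let psi be
a test function close to the indicator of A in L^1.  The integral of f against the translates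
psi (. + s v) is differentiable in s, with derivative minus the integral of the weak
derivative of f in the direction v against the translate; it is nonnegative for all s and almost
0 at s = 0.  The mean value theorem then shows that the integral over A of the weak derivative
is nonpositive, for v as well as for -v.

This argument rests on the density of C^1_c functions in L^1 for indicators of bounded
measurable sets (C1c_approximation) and on the translation invariance of Lebesgue measure
(ge0_integral_shift). *)

Set Implicit Arguments.
Unset Strict Implicit.
Unset Printing Implicit Defensive.

Local Open Scope classical_set_scope.
Local Open Scope ring_scope.

(** * Measurability and finiteness of topological sets *)

(** An open set is the union of the boxes with rational corners that it contains,
and there are countably many of them. *)
Lemma open_measurable_rV {R : realType} n (U : set 'rV[R]_n) :
  open U -> measurable U.
Proof.
move=> oU.
pose box (pq : 'rV[rat]_n * 'rV[rat]_n) := [set x : 'rV[R]_n |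
  forall i, `](ratr (pq.1 ord0 i) : R), ratr (pq.2 ord0 i)[%classic (x ord0 i)].
rewrite (_ : U = \bigcup_(pq in [set pq | box pq `<=` U]) box pq).
  rewrite bigcup_mkcond; apply: countable_bigcupT_measurable.
    exact: countableP.
  move=> pq; case: ifP => // _.
  exact: (@measurable_rV_box R n
    (fun i => `](ratr (pq.1 ord0 i) : R), ratr (pq.2 ord0 i)[%classic)).
apply/seteqP; split=> [x Ux|x [pq]/= pqU /pqU//].
have /nbhs_ballP[e /= e0 xeU] : nbhs x U by apply: open_nbhs_nbhs.
have lo i : {q : rat | x ord0 i - e < ratr q < x ord0 i}.
  by apply: cid; have [|q] := @rat_in_itvoo R (x ord0 i - e) (x ord0 i);
    [rewrite gtrBl|rewrite in_itv/=; exists q].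
have hi i : {q : rat | x ord0 i < ratr q < x ord0 i + e}.
  by apply: cid; have [|q] := @rat_in_itvoo R (x ord0 i) (x ord0 i + e);
    [rewrite ltrDl|rewrite in_itv/=; exists q].
exists (\row_i sval (lo i), \row_i sval (hi i)) => /=; last first.
  move=> i; rewrite /= !mxE in_itv/=.
  by case: (lo i) (hi i) => [p /= /andP[_ ->]] [q /= /andP[-> _]].
move=> y boxy; apply: xeU; split=> // i j; rewrite ord1.
move: (boxy j); rewrite /= !mxE in_itv/=.
case: (lo j) (hi j) => [p /= /andP[p1 p2]] [q /= /andP[q1 q2]] /andP[py yq].
by rewrite /ball/= ltr_distlC; apply/andP; split; lra.
Qed.

Lemma borel_lebesgue_measurable {R : realType} n (A : set 'rV[R]_n) :
  measurable A -> measurable (A : set (lebesgue_rV_type R n)).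
Proof. exact: caratheodory_measurable_mu_ext. Qed.

Lemma open_lebesgue_measurable {R : realType} n (U : set 'rV[R]_n) :
  open U -> measurable (U : set (lebesgue_rV_type R n)).
Proof. by move=> /open_measurable_rV; exact: borel_lebesgue_measurable. Qed.

Lemma closed_lebesgue_measurable {R : realType} n (U : set 'rV[R]_n) :
  closed U -> measurable (U : set (lebesgue_rV_type R n)).
Proof.
by move=> cU; rewrite -(setCK U); apply/measurableC/open_lebesgue_measurable;
  rewrite openC.
Qed.

Lemma rV_hausdorff {R : realType} n : hausdorff_space 'rV[R]_n.
Proof. exact: norm_hausdorff. Qed.

Lemma compact_lebesgue_measurable {R : realType} n (K : set 'rV[R]_n) :
  compact K -> measurable (K : set (lebesgue_rV_type R n)).
Proof.
move=> cK; apply: closed_lebesgue_measurable.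
exact: (compact_closed (@rV_hausdorff R n) cK).
Qed.

Lemma continuous_lebesgue_measurable {R : realType} n (f : 'rV[R]_n -> R) :
  continuous f ->
  measurable_fun setT (f : lebesgue_rV_type R n -> measurableTypeR R).
Proof.
move=> cf; apply: (measurability _ (RGenOpens.measurableE R)).
move=> _ [_ [a [b ->]] <-]; rewrite setTI.
by apply: open_lebesgue_measurable; apply: open_comp => //; exact: interval_open.
Qed.

Lemma mx_norm_coord_le {R : realType} n (x : 'rV[R]_n) i : `|x ord0 i| <= `|x|.
Proof.
have /mapP[j Hj ->] : `|x ord0 i| \in [seq `|x v.1 v.2| | v : 'I_1 * 'I_n].
  by apply/mapP; exists (ord0, i) => //=; rewrite mem_enum.
by rewrite [leRHS]/Num.Def.normr /= mx_normrE; apply/bigmax_geP; right => /=; exists j.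
Qed.

Lemma lebesgue_bounded_lty {R : realType} n (A : set 'rV[R]_n) (r : R) :
  measurable (A : set (lebesgue_rV_type R n)) ->
  (forall x, A x -> `|x| <= r) -> (lebesgue_rV A < +oo)%E.
Proof.
move=> mA Ar; pose B := [set x : 'rV[R]_n |
  forall i, `[- `|r|, `|r|]%classic (x ord0 i)].
have mB : measurable (B : set (lebesgue_rV_type R n)).
  apply: borel_lebesgue_measurable.
  exact: (@measurable_rV_box R n (fun i => `[- `|r|, `|r|]%classic)).
apply: (@le_lt_trans _ _ (lebesgue_rV B)).
  apply: le_measure; rewrite ?inE// => x /Ar xr i /=.
  rewrite in_itv/= -ler_norml (le_trans (mx_norm_coord_le _ _))//.
  by rewrite (le_trans xr) ?ler_norm.
rewrite lebesgue_rV_box ?ltry// => i.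
by rewrite -subr_ge0 opprK addr_ge0.
Qed.

Lemma lebesgue_rV_setT_gt0 {R : realType} n :
  (0 < lebesgue_rV [set: lebesgue_rV_type R n])%E.
Proof.
pose B := [set x : 'rV[R]_n | forall i, `[0, 1]%classic (x ord0 i)].
have mB : measurable (B : set (lebesgue_rV_type R n)).
  apply: borel_lebesgue_measurable.
  exact: (@measurable_rV_box R n (fun i => `[0, 1]%classic)).
apply: (@lt_le_trans _ _ (lebesgue_rV B)).
  rewrite lebesgue_rV_box//.
  by rewrite big1 ?lte01// => i _; rewrite subr0.
by apply: le_measure; rewrite ?inE.
Qed.

(** * Translation invariance of Lebesgue measure *)

Section translation.
Context {R : realType}.
Local Open Scope ereal_scope.

Lemma lebesgue_measure_shift (c : R) (A : set R) : measurable A ->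
  lebesgue_measure [set x | A (x + c)%R] = lebesgue_measure A.
Proof.
have mc : measurable_fun setT (fun x : measurableTypeR R => x + c : measurableTypeR R)%R.
  exact: measurable_funD.
move=> mA; have -> : [set x | A (x + c)%R] =
    (fun x : measurableTypeR R => x + c : measurableTypeR R)%R @^-1` A by [].
rewrite -[LHS]/(pushforward lebesgue_measure
  (fun x : measurableTypeR R => x + c : measurableTypeR R)%R A).
apply/esym/lebesgue_measure_unique => //= _ [[a b]] _ <-.
rewrite /pushforward /=.
rewrite (_ : _ @^-1` _ = `]a - c, b - c]%classic)%R; last first.
  by apply/seteqP; split => x /=; rewrite !in_itv/= ltrBlDr lerBrDr.
rewrite !lebesgue_measure_itv/= !lte_fin ltrD2r.
by case: ifP => // _; rewrite -!EFinB; congr (_%:E); ring.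
Qed.

Lemma rV_cons_add n (p : measurableTypeR R * 'rV[R]_n) (v : 'rV[R]_n.+1) :
  (rV_cons p + v)%R =
  rV_cons ((p.1 + v ord0 ord0)%R : measurableTypeR R,
           (p.2 + (rV_uncons v).2)%R).
Proof.
apply/rowP => i; rewrite mxE; case: (unliftP ord0 i) => [j ->|->].
  by rewrite !rV_consS !mxE.
by rewrite !rV_cons0.
Qed.

(** Induction on the dimension: the first coordinate is handled by the invariance of
the one-dimensional measure, the sections by the induction hypothesis. *)
Lemma lebesgue_rV_borel_shift n (v : 'rV[R]_n) (A : set 'rV[R]_n) :
  measurable A ->
  lebesgue_rV_borel n [set x | A (x + v)%R] = lebesgue_rV_borel n A.
Proof.
elim: n v A => [v A _|n ih v A mA].
  by congr (_ _); apply/funext => x /=; rewrite [v]thinmx0 addr0.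
pose B := @rV_cons R n @^-1` A.
have mB : measurable B.
  by rewrite -[B]setTI; exact: measurable_rV_cons.
rewrite /= /lebesgue_rV_step /pushforward /product_measure1 -/B.
pose c := v ord0 ord0; pose w := (rV_uncons v).2.
pose phi x := lebesgue_rV_borel n (xsection B x).
transitivity (\int[lebesgue_measure]_x phi (x + c)%R).
  apply: eq_integral => x _ /=; rewrite /phi -[RHS](ih w); last first.
    exact: measurable_xsection.
  congr (_ _); apply/seteqP.
  by split => y; rewrite /xsection /= !inE /B /preimage /= rV_cons_add.
have mc : measurable_fun setT (fun x : measurableTypeR R => x + c : measurableTypeR R)%R.
  exact: measurable_funD.
rewrite -[LHS]/(\int[lebesgue_measure]_(x in
  (fun x : measurableTypeR R => x + c : measurableTypeR R)%R @^-1` setT)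
  (phi \o (fun x : measurableTypeR R => x + c : measurableTypeR R)%R) x).
rewrite -(ge0_integral_pushforward mc)//;
  last exact: measurable_fun_xsection.
by apply: eq_measure_integral => D mD _; exact: lebesgue_measure_shift.
Qed.

Lemma measurable_shift_rV n (v : 'rV[R]_n) (A : set 'rV[R]_n) :
  measurable A -> measurable [set x | A (x + v)%R].
Proof.
move=> mA; have : measurable_fun setT (fun x : 'rV[R]_n => x + v)%R.
  apply/measurable_fun_rVP => i; under eq_fun do rewrite mxE.
  by apply: measurable_funD => //; exact: measurable_coord.
by move=> /(_ measurableT A mA); rewrite setTI.
Qed.

(** The measure is an outer measure defined through Borel covers, and translating a
cover translates the set; so invariance holds for all sets, measurable or not. *)
Lemma lebesgue_rV_shift n (v : 'rV[R]_n) (A : set (lebesgue_rV_type R n)) :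
  lebesgue_rV ([set x : 'rV[R]_n | A (x + v)%R] : set (lebesgue_rV_type R n)) =
  lebesgue_rV A.
Proof.
have le w (B : set 'rV[R]_n) :
    mu_ext (lebesgue_rV_borel n) [set x | B (x + w)%R] <=
    mu_ext (lebesgue_rV_borel n) B.
  rewrite /mu_ext; apply: le_ereal_inf_tmp => _ [F [mF BF] <-]; apply: ereal_inf_lbound.
  exists (fun k => [set x | F k (x + w)%R]).
    split=> [k|x /= /BF[k _ Fk]]; first exact: (measurable_shift_rV w (mF k)). 
    by exists k.
  by apply: eq_eseriesr => k _; exact: (lebesgue_rV_borel_shift w (mF k)).
apply/eqP; rewrite eq_le; apply/andP; split; first exact: le.
have := le (- v)%R [set x : 'rV[R]_n | A (x + v)%R].
rewrite (_ : [set x | _] = A)//; apply/seteqP.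
by split => x /=; rewrite subrK.
Qed.

Lemma measurable_lebesgue_shift n (v : 'rV[R]_n) :
  measurable_fun [set: lebesgue_rV_type R n]
    (fun x : 'rV[R]_n => x + v : lebesgue_rV_type R n)%R.
Proof.
move=> _ A mA; rewrite setTI.
pose m := @mu_ext _ _ R (@lebesgue_rV_borel R n).
have shiftE (Y : set 'rV[R]_n) : m [set x | Y (x + v)%R] = m Y.
  exact: (lebesgue_rV_shift v Y).
change (caratheodory_measurable m [set x | A (x + v)%R]) => X.
pose Y : set 'rV[R]_n := [set y | X (y - v)%R].
have {1}-> : X = [set x | Y (x + v)%R].
  by apply/seteqP; split => x; rewrite /Y/= addrK.
rewrite shiftE (mA Y : m Y = m (Y `&` A) + m (Y `&` ~` A)).
rewrite -[m (Y `&` A)]shiftE -[m (Y `&` ~` A)]shiftE.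
by congr (m _ + m _); apply/seteqP; split=> x [/=]; rewrite /Y/= ?addrK.
Qed.

Lemma ge0_integral_shift n (v : 'rV[R]_n) (h : lebesgue_rV_type R n -> \bar R) :
  measurable_fun setT h -> (forall x, 0 <= h x) ->
  \int[lebesgue_rV]_x h (x + v)%R = \int[lebesgue_rV]_x h x.
Proof.
move=> mh h0.
rewrite -[LHS]/(\int[lebesgue_rV]_(x in
  (fun x : 'rV[R]_n => x + v : lebesgue_rV_type R n)%R @^-1` setT)
  (h \o (fun x : 'rV[R]_n => x + v : lebesgue_rV_type R n)%R) x).
rewrite -(ge0_integral_pushforward (measurable_lebesgue_shift v))//.
apply: eq_measure_integral; first exact: measurable_lebesgue_shift.
by move=> mv D mD _; exact: (lebesgue_rV_shift v D).
Qed.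

End translation.

(** * Functions of class C^1 *)

Section continuity.
Context {R : realType} {T : topologicalType}.

Lemma fun_continuousD {V : normedModType R} (f g : T -> V) :
  continuous f -> continuous g -> continuous (fun x => f x + g x).
Proof. by move=> cf cg x; apply: cvgD; [exact: cf|exact: cg]. Qed.

Lemma fun_continuousM (f g : T -> R) :
  continuous f -> continuous g -> continuous (fun x => f x * g x).
Proof. by move=> cf cg x; apply: cvgM; [exact: cf|exact: cg]. Qed.

End continuity.

Section C1.
Context {R : realType} {n : nat}.
Implicit Types (phi psi : 'rV[R]_n -> R) (v x : 'rV[R]_n).

Lemma C1_continuous phi : C1 phi -> continuous phi.
Proof. by move=> [dphi _] x; exact: differentiable_continuous. Qed.

Lemma C1_derivable phi x v : C1 phi -> derivable phi x v.
Proof. by move=> [dphi _]; exact: diff_derivable. Qed.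

Lemma C1_cst (a : R) : C1 (fun _ : 'rV[R]_n => a).
Proof.
split=> [x|v]; first exact: differentiable_cst.
rewrite (_ : 'D_v _ = cst 0); first exact: cst_continuous.
by apply/funext => x; exact: derive_cst.
Qed.

Lemma C1_coord i : C1 (fun x : 'rV[R]_n => x ord0 i).
Proof.
split=> [x|v]; first exact: differentiable_coord.
rewrite (_ : 'D_v _ = cst (v ord0 i)); first exact: cst_continuous.
apply/funext => x; rewrite /derive /=; apply/cvg_lim => //.
apply: cvg_near_cst; near=> h; rewrite !mxE addrK /= scalerA mulVf ?scale1r//.
by near: h; exact: nbhs_dnbhs_neq.
Unshelve. all: by end_near. Qed.

Lemma C1D phi psi : C1 phi -> C1 psi -> C1 (fun x => phi x + psi x).
Proof.
move=> Cphi Cpsi; split=> [x|v].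
  by apply: differentiableD; [exact: Cphi.1|exact: Cpsi.1].
rewrite (_ : 'D_v _ = 'D_v phi \+ 'D_v psi).
  exact: fun_continuousD (Cphi.2 v) (Cpsi.2 v).
by apply/funext => x; apply: deriveD; exact: C1_derivable.
Qed.

Lemma C1M phi psi : C1 phi -> C1 psi -> C1 (fun x => phi x * psi x).
Proof.
move=> Cphi Cpsi; split=> [x|v].
  by apply: differentiableM; [exact: Cphi.1|exact: Cpsi.1].
rewrite (_ : 'D_v _ = (fun x => phi x * 'D_v psi x + psi x * 'D_v phi x)).
  have [cphi cpsi] := (C1_continuous Cphi, C1_continuous Cpsi).
  exact: fun_continuousD (fun_continuousM cphi (Cpsi.2 v))
    (fun_continuousM cpsi (Cphi.2 v)).
by apply/funext => x; apply: deriveM; exact: C1_derivable.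
Qed.

Lemma C1B phi psi : C1 phi -> C1 psi -> C1 (fun x => phi x - psi x).
Proof.
move=> Cphi Cpsi; have CN : C1 (fun x => phi x + (-1) * psi x).
  exact: (C1D Cphi (C1M (C1_cst (-1)) Cpsi)).
by rewrite (_ : (fun x => _) = (fun x => phi x + (-1) * psi x))//;
  apply/funext => x; rewrite mulN1r.
Qed.

Lemma C1_comp (F : R -> R) phi : (forall t, derivable F t 1) ->
  continuous F^`()%classic -> C1 phi -> C1 (F \o phi).
Proof.
move=> dF cF Cphi.
have DF t : differentiable F t by apply/derivable1_diffP.
split=> [x|v]; first by apply: differentiable_comp; [exact: Cphi.1|].
rewrite (_ : 'D_v _ = (fun x => 'D_v phi x * F^`()%classic (phi x))).
  apply: fun_continuousM; first exact: (Cphi.2 v).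
  by move=> x; apply: continuous_comp; [exact: C1_continuous|exact: cF].
apply/funext => x; have Dphi := Cphi.1 x.
rewrite !deriveE//; last exact: differentiable_comp.
by rewrite diff_comp//= diff1E.
Qed.

Lemma C1_shift phi v : C1 phi -> C1 (fun x => phi (x + v)).
Proof.
move=> Cphi; have DE w : 'D_w (fun x => phi (x + v)) = (fun x => 'D_w phi (x + v)).
  apply/funext => x; rewrite /derive.
  rewrite (_ : (fun h : R => _) =
    (fun h : R => h^-1 *: (phi (h *: w + (x + v)) - phi (x + v))))//.
  by apply/funext => h; rewrite /= addrA.
have cv : continuous (fun x => x + v).
  exact: fun_continuousD (fun=> cvg_id) (fun=> cvg_cst _).
split=> [x|w]; last first.
  by rewrite DE => x; exact: (continuous_comp (cv x) (Cphi.2 w (x + v))).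
apply: (@differentiable_comp _ _ _ _ (fun x => x + v) phi); last exact: Cphi.1.
by apply: differentiableD; exact: ex_diff.
Qed.

Lemma is_derive_line phi x v (s : R) : C1 phi ->
  is_derive s (1 : R) (fun t : R => phi (x + t *: v)) ('D_v phi (x + s *: v)).
Proof.
move=> Cphi; have dphi : derivable phi (x + s *: v) v by exact: C1_derivable.
have E : (fun h : R => h^-1 *: (phi (x + (h *: 1 + s) *: v) - phi (x + s *: v)))
       = (fun h : R => h^-1 *: (phi (h *: v + (x + s *: v)) - phi (x + s *: v))).
  by apply/funext => h; rewrite [h *: 1]mulr1 scalerDl addrCA.
by split; rewrite ?/derivable ?/derive /= E.
Qed.

End C1.

Section support.
Context {R : realType} {n : nat}.

Lemma derive_out_support {V : normedModType R} (phi : 'rV[R]_n -> V) v x :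
  ~ closure [set x | phi x != 0] x -> 'D_v phi x = 0.
Proof.
move=> Nx; have [->|v0] := eqVneq v 0; first exact: derive0.
rewrite -(derive_cst (0 : V) x v); apply: near_eq_derive => //.
have : nbhs x (~` closure [set x | phi x != 0]).
  by apply: open_nbhs_nbhs; split=> //; apply: closed_openC; exact: closed_closure.
apply: filterS => y /= Ny; apply/eqP/negP => /negP y0; apply: Ny.
exact: subset_closure.
Qed.

Lemma continuous_bounded_support {V : normedModType R} (h : 'rV[R]_n -> V) K :
  continuous h -> compact K -> (forall x, ~ K x -> h x = 0) ->
  exists2 M : R, 0 < M & forall x, `|h x| <= M.
Proof.
move=> ch cK hK; have : compact (h @` K).
  by apply: continuous_compact => //; exact: continuous_subspaceT.
move=> /compact_bounded[M [_ /(_ (`|M| + 1))]].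
rewrite (le_lt_trans (ler_norm M)) ?ltrDl// => /(_ isT) hM.
exists (`|M| + 1); first by rewrite ltr_wpDl.
move=> x; have [Kx|NKx] := pselect (K x); first by apply: hM; exists x.
by rewrite hK// normr0 addr_ge0.
Qed.

Lemma closed_norm_le (r : R) : closed [set x : 'rV[R]_n | `|x| <= r].
Proof.
apply: (@closed_comp _ _ (fun x : 'rV[R]_n => `|x|) [set t : R | t <= r]).
  by move=> y _; exact: norm_continuous.
exact: closed_le.
Qed.

Lemma compact_norm_le (r : R) : compact [set x : 'rV[R]_n | `|x| <= r].
Proof.
apply: bounded_closed_compact; last exact: closed_norm_le.
exists r; split; first exact: num_real.
by move=> m rm x xr; exact: le_trans xr (ltW rm).
Qed.

Lemma C1c_bounded_support (phi : 'rV[R]_n -> R) (r : R) :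
  C1 phi -> (forall x, r < `|x| -> phi x = 0) -> C1c setT phi.
Proof.
move=> Cphi phi0; split=> //.
apply: bounded_closed_compact; last exact: closed_closure.
exists r; split; first exact: num_real.
move=> M rM x clx; apply: le_trans (ltW rM).
move: x clx; rewrite closureE; apply: smallest_sub => [|y /= y0].
  exact: closed_norm_le.
by rewrite leNgt; apply/negP => /phi0 /eqP; exact/negP.
Qed.

End support.

Section cutoff.
Context {R : realType}.

(** The square of the positive part is the simplest C^1 function that vanishes exactly
on the nonpositive half line. *)
Definition sqr_pos (t : R) := (Num.max t 0) ^+ 2.

Lemma is_derive_sqr_pos (t : R) : is_derive t (1 : R) sqr_pos (2 * Num.max t 0).
Proof.
have cvgp : h^-1 *: (sqr_pos (h *: 1 + t) - sqr_pos t) @[h --> 0^'] -->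
    2 * Num.max t 0.
  apply/cvgrPdist_le => e e0; near=> h.
  have h0 : h != 0 by near: h; exact: nbhs_dnbhs_neq.
  have he : `|h| <= e.
    near: h; apply: nbhs_dnbhs; exact: (@nbhs0_le _ R^o).
  apply: le_trans he; rewrite [h *: 1]mulr1 /sqr_pos.
  have hn0 : 0 < `|h| by rewrite normr_gt0.
  rewrite -(ler_pM2l hn0) -normrM mulrBr [h * (h^-1 *: _)]mulrA mulfV// mul1r.
  rewrite -expr2 real_normK ?num_real//.
  rewrite ler_norml; case: (leP t 0) => t0; case: (leP (h + t) 0) => ht0;
    apply/andP; split; nra.
split; first by apply/cvg_ex; eexists; exact: cvgp.
exact: cvg_lim cvgp.
Unshelve. all: by end_near. Qed.
End cutoff.

(** * Bump functions approximating indicators of open sets *)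

Section bump.
Context {R : realType}.

Lemma continuous_derive1_sqr_pos : continuous (@sqr_pos R)^`()%classic.
Proof.
rewrite (_ : _^`()%classic = fun t : R => 2 * Num.max t 0).
  move=> t; apply: cvgM; first exact: cvg_cst.
  by apply: (@continuous_max _ _ id (cst 0)); [exact: cvg_id|exact: cvg_cst].
by apply/funext => t; rewrite derive1E; have /@derive_val -> := is_derive_sqr_pos t.
Qed.

(** As m grows, this increases from 0 to the indicator of the positive half line, while
staying C^1; composed with a C^1 function c, it approximates the indicator of the open
set where c is positive. *)
Definition exp_bump (m : nat) (t : R) : R := 1 - expR (- (m%:R * sqr_pos t)).

Lemma exp_bump_ge0 m t : 0 <= exp_bump m t.
Proof. by rewrite subr_ge0 -expR0 ler_expR oppr_le0 mulr_ge0// sqr_ge0. Qed.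

Lemma exp_bump_le1 m t : exp_bump m t <= 1.
Proof. by rewrite gerBl expR_ge0. Qed.

Lemma exp_bump_le0 m t : t <= 0 -> exp_bump m t = 0.
Proof.
by move=> t0; rewrite /exp_bump /sqr_pos max_r// expr0n mulr0 oppr0 expR0 subrr.
Qed.

Lemma cvg_exp_bump t : exp_bump m t @[m --> \oo] --> ((0 < t)%R%:R : R).
Proof.
have [t0|t0] := leP t 0.
  by rewrite (_ : exp_bump^~ t = cst 0); [exact: cvg_cst|
    apply/funext => m; rewrite exp_bump_le0].
have s0 : 0 < sqr_pos t by rewrite /sqr_pos max_l ?exprn_gt0// ltW.
rewrite -[X in _ --> X]subr0; apply: cvgB; first exact: cvg_cst.
rewrite (_ : (fun m => _) = (fun m => expR (- sqr_pos t) ^+ m)).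
  apply: cvg_expr; rewrite ger0_norm ?expR_ge0//.
  by rewrite -expR0 ltr_expR oppr_lt0.
by apply/funext => m; rewrite -expRM_natl mulrN.
Qed.

Lemma C1_exp_bump n m (c : 'rV[R]_n -> R) : C1 c ->
  C1 (fun x => exp_bump m (c x)).
Proof.
move=> Cc; apply: C1B; first exact: C1_cst.
have Cs : C1 (@sqr_pos R \o c).
  apply: C1_comp => //; last exact: continuous_derive1_sqr_pos.
  by move=> t; have [] := is_derive_sqr_pos t.
have := C1_comp (@derivable_expR R) _ (C1M (C1_cst (- m%:R)) Cs).
rewrite /comp /=; under eq_fun do rewrite mulNr.
apply; rewrite (_ : _^`()%classic = expR); first exact: continuous_expR.
by apply/funext => t; rewrite derive1E derive_val.
Qed.

End bump.

(** * Domination estimates for integrals *)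

Section integral_tools.
Context d (T : measurableType d) {R : realType}.
Variable mu : {measure set T -> \bar R}.
Implicit Types (f g h : T -> R) (D Q : set T).

Lemma measurable_EFin_norm D h : measurable_fun D h ->
  measurable_fun D (fun x => `|h x|%:E).
Proof. by move=> mh; apply/measurable_EFinP; exact: measurableT_comp. Qed.

(** Triangle inequality in L^1, stated through a pointwise bound on the integrands. *)
Lemma le_integral_normD D f g h : measurable D ->
  measurable_fun D f -> measurable_fun D g -> measurable_fun D h ->
  (forall x, D x -> `|f x| <= `|g x| + `|h x|) ->
  (\int[mu]_(x in D) `|f x|%:E <=
   \int[mu]_(x in D) `|g x|%:E + \int[mu]_(x in D) `|h x|%:E)%E.
Proof.
move=> mD mf mg mh fgh; rewrite -ge0_integralD//; try exact: measurable_EFin_norm.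
apply: ge0_le_integral => //; try exact: measurable_EFin_norm.
by apply: emeasurable_funD; exact: measurable_EFin_norm.
Qed.

(** Dominated convergence to 0, reduced to the single index that the estimates need. *)
Lemma dominated_small Q (h : nat -> T -> R) (G : T -> R) (e : R) :
  measurable Q -> (forall m, measurable_fun Q (h m)) ->
  mu.-integrable Q (EFin \o G) ->
  (forall m x, Q x -> `|h m x| <= G x) ->
  (forall x, Q x -> h m x @[m --> \oo] --> 0) -> 0 < e ->
  exists m, (\int[mu]_(x in Q) `|h m x|%:E <= e%:E)%E.
Proof.
move=> mQ mh iG hG h0 e0.
have mh' m : measurable_fun Q (fun x => (h m x)%:E) by exact/measurable_EFinP.
have h0' : {ae mu, forall x, Q x -> (h m x)%:E @[m --> \oo] --> 0%E}.
  by apply: aeW => x Qx; apply: cvg_EFin; [exact: nearW|exact: h0].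
have hG' : {ae mu, forall x (m : nat), Q x -> (`|(h m x)%:E| <= (G x)%:E)%E}.
  by apply: aeW => x m Qx; rewrite lee_fin hG.
have [_ cv _] := dominated_convergence mQ mh' (measurable_cst 0%E) h0' iG hG'.
have e0' : (0 < e%:E)%E by rewrite lte_fin.
have /cv : nbhs (0%E : \bar R) [set y | (y < e%:E)%E] by exact: open_ereal_lt'.
move=> [m _ /(_ m (leqnn m)) /= /ltW le_e]; exists m.
by rewrite (eq_integral (fun x => `|(h m x)%:E - 0|)%E)// => x _; rewrite sube0.
Qed.

End integral_tools.

(** * Density of C^1_c in L^1 for bounded sets *)

Section density.
Context {R : realType} {n : nat}.
Notation leb := (@lebesgue_rV R n).
Notation rVn := (lebesgue_rV_type R n).
Implicit Types (A Q : set 'rV[R]_n) (u psi : 'rV[R]_n -> R).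

(** The functions u range over all of C^1 with values in [0, 1], so that the class of
approximable sets is stable under complement; the cutoff comes after, in C1c_approximation. *)
Definition C1_approximable Q A := forall e : R, 0 < e ->
  exists u, [/\ C1 u, forall x, 0 <= u x <= 1 &
    (\int[leb]_(x in Q) `|u x - \1_A x|%:E <= e%:E)%E].

Lemma C1_measurable u (D : set rVn) : C1 u -> measurable D ->
  measurable_fun D (u : rVn -> R).
Proof.
move=> Cu mD; apply: (measurable_funS measurableT (@subsetT _ _)).
exact: (continuous_lebesgue_measurable (C1_continuous Cu)).
Qed.

Lemma indic_measurable A (D : set rVn) : measurable (A : set rVn) ->
  measurable_fun D (\1_A : rVn -> R).
Proof. by move=> mA; exact: measurable_indic. Qed.

Section approximation.
Variable Q : set rVn.
Hypotheses (mQ : measurable Q) (finQ : (leb Q < +oo)%E).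

Let intQ c : leb.-integrable Q (EFin \o cst c).
Proof.
apply: measurable_bounded_integrable => //.
exact: bounded_cst.
Qed.

Lemma C1_approximable0 : C1_approximable Q set0.
Proof.
move=> r r0; exists (fun=> 0); split; first exact: C1_cst.
  by move=> x; rewrite ler01 lexx.
under eq_integral do rewrite indic0 subrr normr0.
by rewrite integral0 lee_fin ltW.
Qed.

Lemma C1_approximableC A : measurable (A : set rVn) ->
  C1_approximable Q A -> C1_approximable Q (~` A).
Proof.
move=> mA aA e /aA[u [Cu u01 ue]]; exists (fun x => 1 - u x); split.
- exact: C1B (C1_cst 1) Cu.
- by move=> x; have := u01 x; lra.
- apply: le_trans ue; rewrite le_eqVlt; apply/orP; left; apply/eqP.
  apply: eq_integral => x _; congr (_%:E); rewrite -normrN; congr (`|_|).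
  rewrite !indicE in_setC; case: (x \in A) => /=; ring.
Qed.

Lemma C1_approximableI A B : measurable (A : set rVn) ->
  measurable (B : set rVn) ->
  C1_approximable Q A -> C1_approximable Q B -> C1_approximable Q (A `&` B).
Proof.
move=> mA mB aA aB e e0; have e2 : 0 < e / 2 by lra.
have [u [Cu u01 ue]] := aA _ e2; have [v [Cv v01 ve]] := aB _ e2.
exists (fun x => u x * v x); split.
- exact: C1M.
- by move=> x; have := u01 x; have := v01 x; nra.
- rewrite (_ : e = e / 2 + e / 2); last by field.
  rewrite EFinD; apply: le_trans (leeD ue ve).
  have mu' : measurable_fun Q (fun x => u x - \1_A x).
    by apply: measurable_funB; [exact: C1_measurable|exact: indic_measurable].
  have mv' : measurable_fun Q (fun x => v x - \1_B x).
    by apply: measurable_funB; [exact: C1_measurable|exact: indic_measurable].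
  have muv : measurable_fun Q (fun x => u x * v x - \1_(A `&` B) x).
    apply: measurable_funB; first exact: (C1_measurable (C1M Cu Cv) mQ).
    by apply: indic_measurable; exact: measurableI.
  apply: (le_integral_normD leb mQ muv mu' mv') => x _.
  have := u01 x; have := v01 x; rewrite !indicE in_setI.
  have -> : u x * v x - ((x \in A) && (x \in B))%:R =
     u x * (v x - (x \in B)%:R) + (u x - (x \in A)%:R) * (x \in B)%:R.
    by rewrite mulrBr mulrBl -natrM mulnb; ring.
  move=> _ /andP[u0 u1]; rewrite (le_trans (ler_normD _ _))// !normrM addrC.
  apply: lerD; first by rewrite ler_piMr// ger0_norm//; case: (_ \in _).
  by rewrite ler_piMl// ger0_norm.
Qed.

(** Finite unions are reached through complements and intersections; a countable union
is the limit of its finite parts by dominated convergence on Q. *)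
Lemma C1_approximable_bigcup (F : nat -> set 'rV[R]_n) :
  (forall k, measurable (F k : set rVn)) ->
  (forall k, C1_approximable Q (F k)) -> C1_approximable Q (\bigcup_k F k).
Proof.
move=> mF aF e e0; have e2 : 0 < e / 2 by lra.
pose B m := \big[setU/set0]_(k < m) F k.
have mB m : measurable (B m : set rVn) by exact: bigsetU_measurable.
have aB m : C1_approximable Q (B m).
  suff : measurable (B m : set rVn) /\ C1_approximable Q (B m) by case.
  rewrite /B; elim/big_ind : _ => // [|C D [mC aC] [mD aD]]; last first.
    split; first exact: measurableU.
    rewrite -[_ `|` _]setCK setCU; apply: C1_approximableC.
      by apply: measurableI; exact: measurableC.
    by apply: C1_approximableI; try exact: measurableC; exact: C1_approximableC.
  by split; [exact: measurable0|exact: C1_approximable0].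
have BE m x : B m x <-> exists2 k, (k < m)%N & F k x.
  by rewrite /B -bigcup_mkord.
have [m hm] : exists m, (\int[leb]_(x in Q)
    `|\1_(B m) x - \1_(\bigcup_k F k) x|%:E <= (e / 2)%:E)%E.
  apply: (dominated_small mQ _ (intQ 1) _ _ e2).
  - move=> m; apply: measurable_funB; apply: indic_measurable; first exact: mB.
    exact: bigcupT_measurable.
  - move=> m x _ /=; rewrite !indicE.
    by case: (_ \in _); case: (_ \in _);
      rewrite /= ?subrr ?subr0 ?sub0r ?normrN ?normr0 ?normr1.
  - move=> x _; apply: cvg_near_cst.
    have [[k _ Fkx]|NF] := pselect ((\bigcup_k F k) x).
      near=> m; have Bx : B m x.
        by apply/BE; exists k => //; near: m; exists k.+1.
      by rewrite /= !indicE (mem_set Bx) mem_set ?subrr//; exists k.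
    near=> m; have Bx : ~ B m x by move=> /BE[k _ Fk]; apply: NF; exists k.
    by rewrite /= !indicE (memNset Bx) (memNset NF) subrr.
have [u [Cu u01 ue]] := aB m _ e2; exists u; split => //.
rewrite (_ : e = e / 2 + e / 2); last by field.
rewrite EFinD; apply: le_trans (leeD ue hm).
have mU : measurable (\bigcup_k F k : set rVn) by exact: bigcupT_measurable.
have m1 : measurable_fun Q (fun x => u x - \1_(B m) x).
  by apply: measurable_funB; [exact: C1_measurable|exact: indic_measurable].
have m2 : measurable_fun Q (fun x => \1_(B m) x - \1_(\bigcup_k F k) x : R).
  by apply: measurable_funB; exact: indic_measurable.
have m3 : measurable_fun Q (fun x => u x - \1_(\bigcup_k F k) x).
  by apply: measurable_funB; [exact: C1_measurable|exact: indic_measurable].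
apply: (le_integral_normD leb mQ m3 m1 m2).
by move=> x _; rewrite (le_trans _ (ler_normD _ _))// addrA subrK.
Unshelve. all: by end_near. Qed.

Lemma C1_approximable_pos (c : 'rV[R]_n -> R) :
  C1 c -> C1_approximable Q [set x | 0 < c x].
Proof.
move=> Cc e e0.
have mc : measurable ([set x | 0 < c x] : set rVn).
  apply: open_lebesgue_measurable; apply: (@open_comp _ _ c [set t | 0 < t]).
    by move=> x _; exact: C1_continuous.
  exact: open_gt.
have [m hm] : exists m, (\int[leb]_(x in Q)
    `|exp_bump m (c x) - \1_[set x | 0 < c x] x|%:E <= e%:E)%E.
  apply: (dominated_small mQ _ (intQ 1) _ _ e0).
  - move=> m; apply: measurable_funB; last exact: indic_measurable.
    exact: (C1_measurable (C1_exp_bump m Cc) mQ).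
  - move=> m x _ /=; rewrite indicE.
    have := exp_bump_ge0 m (c x); have := exp_bump_le1 m (c x).
    by case: (_ \in _) => /= ? ?; rewrite ler_norml; lra.
  - move=> x _; rewrite indicE mem_setE -[X in _ --> X](subrr ((0 < c x)%R%:R : R)).
    by apply: cvgB; [exact: cvg_exp_bump|exact: cvg_cst].
exists (fun x => exp_bump m (c x)); split; [exact: C1_exp_bump| |exact: hm].
by move=> x; rewrite exp_bump_ge0 exp_bump_le1.
Qed.

Lemma C1_approximable_coord i (Y : set R) :
  measurable (Y : set (measurableTypeR R)) ->
  C1_approximable Q [set x | Y (x ord0 i)].
Proof.
have mX Z : measurable (Z : set (measurableTypeR R)) ->
    measurable ([set x : 'rV[R]_n | Z (x ord0 i)] : set rVn).
  move=> mZ; apply: borel_lebesgue_measurable.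
  by have := @measurable_coord R n i measurableT Z mZ; rewrite setTI.
pose S : set (set R) := [set Z | measurable (Z : set (measurableTypeR R)) /\
  C1_approximable Q [set x | Z (x ord0 i)]].
move=> mY; suff : S Y by case.
move: Y mY.
change ((measurable : set (set (measurableTypeR R))) `<=` S).
rewrite [X in X `<=` _](measurable_realfun.RGenOInfty.measurableE R).
apply: smallest_sub => [|_ [a ->]].
  split.
  - split; first exact: measurable0.
    exact: C1_approximable0.
  - move=> Z [mZ aZ]; rewrite setTD; split; first exact: measurableC.
    exact: (C1_approximableC (mX _ mZ) aZ).
  - move=> F FS; split; first by apply: bigcupT_measurable => k; have [] := FS k.
    change (C1_approximable Q (\bigcup_k [set x : 'rV[R]_n | F k (x ord0 i)])).
    apply: C1_approximable_bigcup => k; have [mF aF] := FS k => //.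
    exact: mX.
split; first exact: measurable_itv.
have := C1_approximable_pos (C1B (C1_coord i) (C1_cst a)).
congr (C1_approximable _ _); apply/seteqP.
by split=> x /=; rewrite in_itv/= andbT subr_gt0.
Qed.

(** The approximable sets form a sigma-algebra, which contains the sets cut out by one
coordinate, and these generate the Borel sets. *)
Lemma C1_approximable_borel A : measurable A -> C1_approximable Q A.
Proof.
pose S : set (set 'rV[R]_n) := [set A | measurable A /\ C1_approximable Q A].
move=> mA; suff : S A by case.
move: A mA; apply: smallest_sub => [|A].
  split.
  - split; first exact: measurable0.
    exact: C1_approximable0.
  - move=> Z [mZ aZ]; rewrite setTD; split; first exact: measurableC.
    exact: (C1_approximableC (borel_lebesgue_measurable mZ) aZ).
  - move=> F FS; split; first by apply: bigcupT_measurable => k; have [] := FS k.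
    apply: C1_approximable_bigcup => k; have [mF aF] := FS k => //.
    exact: borel_lebesgue_measurable.
rewrite -bigcup_seq => -[i /= _ [Y mY <-]]; rewrite setTI; split.
  by have := @measurable_coord R n i measurableT Y mY; rewrite setTI.
exact: C1_approximable_coord.
Qed.

End approximation.

(** Passes from Borel sets to Lebesgue sets: the measure of A is an infimum over Borel
covers. *)
Lemma lebesgue_outer_cover A (e : R) : measurable (A : set rVn) ->
  (leb A < +oo)%E -> 0 < e ->
  exists B : set 'rV[R]_n, [/\ measurable B, A `<=` B &
    (leb (B `\` A : set rVn) <= e%:E)%E].
Proof.
move=> mA Afin e0.
have Afn : leb A \is a fin_num by rewrite ge0_fin_numE.
have [_ [F [mF AF] <-] Fe] := lb_ereal_inf_adherent e0 Afn.
have mU' : measurable (\bigcup_k F k : set 'rV[R]_n).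
  by apply: bigcupT_measurable => k; exact: mF.
have mU := borel_lebesgue_measurable mU'.
have leU : (leb (\bigcup_k F k : set rVn) <= leb A + e%:E)%E.
  apply: le_trans (ltW Fe).
  rewrite [leLHS](lebesgue_rV_borelE mU').
  exact: measure_sigma_subadditive.
exists (\bigcup_k F k); split => //.
rewrite measureD//; last first.
  by apply: le_lt_trans leU _; rewrite lte_add_pinfty// ltry.
by rewrite setIidr// leeBlDl.
Qed.

Lemma mx_norm_le (x : 'rV[R]_n) (M : R) :
  0 <= M -> (forall i, `|x ord0 i| <= M) -> `|x| <= M.
Proof.
move=> M0 xM; rewrite [leLHS]/Num.Def.normr /= mx_normrE.
by apply: bigmax_le => // -[i j] _; rewrite ord1; exact: xM.
Qed.

(** The witness is a constant minus the squared Euclidean norm.  The set where it is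
positive is the ball on which approximation is carried out, and its bumps are the cutoffs. *)
Lemma C1_bounded_positivity (r : R) : exists (c : 'rV[R]_n -> R) (M : R),
  [/\ C1 c, forall x, `|x| <= r -> 0 < c x & forall x, 0 < c x -> `|x| <= M].
Proof.
pose q (x : 'rV[R]_n) : R := \sum_(i < n) x ord0 i * x ord0 i.
have Cq : C1 q.
  rewrite /q; elim: (index_enum _) => [|i s ih].
    by under eq_fun do rewrite big_nil; exact: C1_cst.
  under eq_fun do rewrite big_cons.
  exact: C1D (C1M (C1_coord i) (C1_coord i)) ih.
have [M ME] : exists M : R, M = \sum_(i < n) r ^+ 2 + 1 by eexists.
have M1 : 1 <= M by rewrite ME lerDr sumr_ge0// => i _; exact: sqr_ge0.
exists (fun x => M - q x), M; split.
- exact: C1B (C1_cst M) Cq.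
- move=> x xr; rewrite subr_gt0 ME ltr_pwDr// ler_sum// => i _.
  have := le_trans (mx_norm_coord_le x i) xr.
  rewrite ler_norml => /andP[]; set y := x ord0 i => ? ?.
  rewrite -subr_ge0 (_ : r ^+ 2 - y * y = (r - y) * (r + y)); last by ring.
  by apply: mulr_ge0; lra.
- move=> x; rewrite subr_gt0 => qM; apply: mx_norm_le => [|i]; first exact: le_trans M1.
  have : x ord0 i * x ord0 i <= q x.
    rewrite /q (bigD1 i)//= lerDl sumr_ge0// => j _.
    by rewrite -expr2 sqr_ge0.
  rewrite -expr2 -real_normK ?num_real// => yq; rewrite leNgt; apply/negP => My.
  have y1 : 1 <= `|x ord0 i| by exact: le_trans M1 (ltW My).
  have := le_lt_trans (le_trans (ler_eXnr (isT : (0 < 2)%N) y1) yq) qM.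
  by rewrite ltNge (ltW My).
Qed.

(** The radius M of the supports depends on r only.  This uniformity matters because a
weak gradient is only locally integrable: the approximations of A must live in one fixed
compact set. *)
Theorem C1c_approximation (r : R) : exists M : R, forall A (e : R),
  measurable (A : set rVn) -> (forall x, A x -> `|x| <= r) -> 0 < e ->
  exists psi, [/\ C1 psi, forall x, M < `|x| -> psi x = 0,
    forall x, 0 <= psi x <= 1 &
    (\int[leb]_x `|psi x - \1_A x|%:E <= e%:E)%E].
Proof.
have [c [M [Cc cr cM]]] := C1_bounded_positivity r.
exists M => A e mA Ar e0; have e3 : 0 < e / 3 by lra.
pose Q : set rVn := [set x | 0 < c x].
have mQ : measurable Q.
  apply: open_lebesgue_measurable; apply: (@open_comp _ _ c [set t | 0 < t]).
    by move=> x _; exact: C1_continuous.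
  exact: open_gt.
have finQ : (leb Q < +oo)%E by exact: (lebesgue_bounded_lty mQ cM).
have [B [mB AB BAe]] :=
  lebesgue_outer_cover mA (lebesgue_bounded_lty mA Ar) e3.
have mB' := borel_lebesgue_measurable mB.
have [u [Cu u01 ue]] := C1_approximable_borel mQ finQ mB e3.
have Cm m : C1 (fun x => exp_bump m (c x)) by exact: C1_exp_bump.
have [m me] : exists m, (\int[leb]_(x in Q)
    `|exp_bump m (c x) - 1|%:E <= (e / 3)%:E)%E.
  apply: (dominated_small (G := cst 1) mQ _ _ _ _ e3).
  - move=> m; apply: measurable_funB; last exact: measurable_cst.
    exact: (C1_measurable (Cm m) mQ).
  - apply: (measurable_bounded_integrable mQ finQ); first exact: measurable_cst.
    exact: bounded_cst.
  - move=> m x _ /=; have := exp_bump_ge0 m (c x); have := exp_bump_le1 m (c x).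
    by move=> ? ?; rewrite ler_norml; lra.
  - move=> x Qx; rewrite -[X in _ --> X](subrr (1 : R)).
    by apply: cvgB; [rewrite -[X in _ --> X]/(true%:R) -Qx; exact: cvg_exp_bump
      |exact: cvg_cst].
pose psi x := exp_bump m (c x) * u x.
have b01 x := conj (exp_bump_ge0 m (c x)) (exp_bump_le1 m (c x)).
have psi0 x : ~ Q x -> psi x = 0.
  move=> Qx; rewrite /psi exp_bump_le0 ?mul0r// leNgt.
  by apply/negP => ?; apply: Qx.
exists psi; split.
- exact: C1M (Cm m) Cu.
- move=> x Mx; apply: psi0 => /cM; rewrite leNgt.
  by move/negP; apply.
- move=> x; have [b0 b1] := b01 x; have /andP[u0 u1] := u01 x.
  by rewrite mulr_ge0// mulr_ile1.
- rewrite (_ : (\int[leb]_x _)%E =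
      (\int[leb]_(x in Q) `|psi x - \1_A x|%:E)%E); last first.
    rewrite [RHS]integral_mkcond; apply: eq_integral => x _.
    rewrite patchE; case: ifPn => // /negP Qx.
    rewrite psi0 => [|Qx']; last by apply: Qx; rewrite inE.
    rewrite indicE memNset ?subrr ?normr0// => /Ar /cr Qx'.
    by apply: Qx; rewrite inE.
  have mfA : measurable_fun Q (\1_A : rVn -> R) by exact: indic_measurable.
  have mfB : measurable_fun Q (\1_B : rVn -> R) by exact: indic_measurable.
  have mfu : measurable_fun Q (u : rVn -> R) by exact: C1_measurable Cu mQ.
  have mfc : measurable_fun Q (fun x : rVn => exp_bump m (c x)).
    exact: C1_measurable (Cm m) mQ.
  have mpsi : measurable_fun Q (psi : rVn -> R) by exact: measurable_funM.
  have mBA : (\int[leb]_(x in Q) `|\1_B x - \1_A x|%:E <= (e / 3)%:E)%E.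
    apply: le_trans BAe.
    rewrite (eq_integral (fun x : rVn => (\1_(B `\` A) x)%:E)) => [|x _]; last first.
      congr (_%:E); rewrite !indicE in_setD.
      have [xA|xA] := boolP (x \in A).
        by rewrite (mem_set (AB _ (set_mem xA))) /= subrr normr0.
      by rewrite subr0 andbT ger0_norm.
    have mD : measurable (B `\` A : set rVn) by exact: measurableD.
    rewrite integral_indic//; apply: le_measure; rewrite ?inE//.
    exact: measurableI.
  have mf1 : measurable_fun Q (fun x => psi x - \1_A x).
    exact: measurable_funB.
  have mf2 : measurable_fun Q (fun x => exp_bump m (c x) - 1).
    exact: measurable_funB.
  have mf3 : measurable_fun Q (fun x => u x - \1_A x).
    exact: measurable_funB.
  have mf4 : measurable_fun Q (fun x => u x - \1_B x).
    exact: measurable_funB.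
  have mf5 : measurable_fun Q (fun x => \1_B x - \1_A x : R).
    exact: measurable_funB.
  rewrite (_ : e = e / 3 + (e / 3 + e / 3)); last by field.
  rewrite !EFinD; apply: le_trans (leeD me (le_trans _ (leeD ue mBA))).
    apply: (le_integral_normD leb mQ mf1 mf2 mf3) => x _.
    have -> : psi x - \1_A x =
        (exp_bump m (c x) - 1) * u x + (u x - \1_A x) by rewrite /psi; ring.
    rewrite (le_trans (ler_normD _ _))// lerD2r normrM ler_piMr//.
    by have /andP[u0 u1] := u01 x; rewrite ger0_norm.
  apply: (le_integral_normD leb mQ mf3 mf4 mf5) => x _.
  by rewrite (le_trans _ (ler_normD _ _))// addrA subrK.
Qed.

End density.

(** * Absolute continuity and small translations *)

Section small.
Context d (T : measurableType d) {R : realType}.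
Variable mu : {measure set T -> \bar R}.

(** Absolute continuity of the integral: split g at a large height m.  The part above m
has a small integral, and below m the weight u costs at most a multiple of its own integral. *)
Lemma integral_small_weight (Q : set T) (g : T -> R) (e : R) :
  measurable Q -> mu.-integrable Q (EFin \o g) -> 0 < e ->
  exists2 delta : R, 0 < delta & forall u : T -> R, measurable_fun Q u ->
    (forall x, Q x -> `|u x| <= 1) ->
    (\int[mu]_(x in Q) `|u x|%:E <= delta%:E)%E ->
    (\int[mu]_(x in Q) `|g x * u x|%:E <= e%:E)%E.
Proof.
move=> mQ ig e0; have e2 : 0 < e / 2 by lra.
have mg : measurable_fun Q g by apply/measurable_EFinP; exact: measurable_int ig.
pose tail (m : nat) x := if m%:R < `|g x| then g x else 0.
have mtail m : measurable_fun Q (tail m).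
  apply: measurable_fun_if => //.
    apply: measurable_fun_ltr; first exact: measurable_cst.
    exact: measurableT_comp.
  exact: (measurable_funS mQ (@subIsetl _ _ _) mg).
have ing : mu.-integrable Q (EFin \o (fun x => `|g x|)).
  exact: integrable_norm.
have [m hm] : exists m, (\int[mu]_(x in Q) `|tail m x|%:E <= (e / 2)%:E)%E.
  apply: (dominated_small mQ mtail ing _ _ e2).
    by move=> m x _; rewrite /tail; case: ifP => _ //; rewrite normr0.
  move=> x _; apply: cvg_near_cst; near=> m; rewrite /tail ltNge.
  suff -> : `|g x| <= m%:R by [].
  by near: m; exact: nbhs_infty_ger.
have m1 : 0 < m%:R + 1 :> R by rewrite ltr_wpDl.
exists (e / 2 / (m%:R + 1)); first exact: divr_gt0.
move=> u mu1 u1 ule.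
have mgu : measurable_fun Q (fun x => g x * u x) by exact: measurable_funM.
have mmu : measurable_fun Q (fun x => (m%:R + 1) * u x).
  by apply: measurable_funM => //; exact: measurable_cst.
rewrite [e]splitr EFinD.
have mule : (\int[mu]_(x in Q) `|(m%:R + 1) * u x|%:E <= (e / 2)%:E)%E.
  under eq_integral do rewrite normrM (ger0_norm (ltW m1)) EFinM.
  rewrite ge0_integralZl// ?lee_fin ?(ltW m1)//; last exact: measurable_EFin_norm.
  apply: (@le_trans _ _ ((m%:R + 1)%:E * (e / 2 / (m%:R + 1))%:E)%E).
    by apply: lee_wpmul2l => //; rewrite lee_fin ltW.
  by rewrite -EFinM mulrC divfK// gt_eqF.
apply: le_trans (leeD hm mule).
apply: (le_integral_normD mu mQ mgu (mtail m) mmu) => x Qx.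
rewrite /tail !normrM (ger0_norm (ltW m1)); have := u1 x Qx.
case: ltP => gm ux.
  by rewrite ler_wpDr ?mulr_ge0 ?(ltW m1)// ler_piMr.
rewrite normr0 add0r ler_wpM2r// (le_trans gm)// lerDl//.
Unshelve. all: by end_near. Qed.

End small.

Section shifts.
Context {R : realType} {n : nat}.
Notation leb := (@lebesgue_rV R n).
Notation rVn := (lebesgue_rV_type R n).

Lemma C1_support_bound (psi : 'rV[R]_n -> R) (v : 'rV[R]_n) (M : R) :
  C1 psi -> (forall x, M < `|x| -> psi x = 0) ->
  exists2 L : R, 0 < L & forall x, `|'D_v psi x| <= L.
Proof.
move=> Cpsi psi0; have [_ cK _] := C1c_bounded_support Cpsi psi0.
apply: (continuous_bounded_support (Cpsi.2 v) cK) => x.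
exact: derive_out_support.
Qed.

Lemma C1_line_lipschitz (psi : 'rV[R]_n -> R) (v : 'rV[R]_n) (L s : R) x :
  C1 psi -> (forall x, `|'D_v psi x| <= L) -> 0 <= s ->
  `|psi (x + s *: v) - psi x| <= s * L.
Proof.
move=> Cpsi hL; rewrite le_eqVlt => /predU1P[<-|s0].
  by rewrite scale0r addr0 subrr normr0 mul0r.
pose F (t : R) := psi (x + t *: v).
have dF t : is_derive t (1 : R) F ('D_v psi (x + t *: v)).
  exact: is_derive_line.
have cF : {within `[0, s], continuous F}.
  apply: continuous_subspaceT => t; apply: differentiable_continuous.
  by apply/derivable1_diffP; have [] := dF t.
have [t _] := MVT s0 (fun t _ => dF t) cF.
rewrite /F scale0r addr0 subr0 => ->.
by rewrite normrM (ger0_norm (ltW s0)) mulrC ler_wpM2l// ltW.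
Qed.

(** The translates differ by at most s times a bound for the derivative, on a bounded set. *)
Lemma shift_small (psi : 'rV[R]_n -> R) (v : 'rV[R]_n) (M e : R) :
  C1 psi -> (forall x, M < `|x| -> psi x = 0) -> `|v| <= 1 -> 0 < e ->
  exists2 tau : R, 0 < tau <= 1 & forall s, 0 <= s <= tau ->
    (\int[leb]_x `|psi (x + s *: v)%R - psi x|%:E <= e%:E)%E.
Proof.
move=> Cpsi psi0 v1 e0.
have [L L0 hL] := C1_support_bound v Cpsi psi0.
pose K : set rVn := [set x : 'rV[R]_n | `|x| <= M + 1].
have mK : measurable K by apply: closed_lebesgue_measurable; exact: closed_norm_le.
have finK : (leb K < +oo)%E by exact: (lebesgue_bounded_lty mK (fun x Kx => Kx)).
have [k k0 kK] : exists2 k : R, 0 < k & (leb K <= k%:E)%E.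
  exists (fine (leb K) + 1); first by rewrite ltr_wpDl// fine_ge0.
  by rewrite EFinD fineK ?ge0_fin_numE// leeDl.
have LK : 0 < L * k by exact: mulr_gt0.
exists (Num.min 1 (e / (L * k))).
  by rewrite lt_min ltr01 divr_gt0//= ge_min lexx.
move=> s /andP[s0]; rewrite le_min => /andP[s1 se].
have mK1 : measurable_fun [set: rVn] (fun x => (\1_K x)%:E : \bar R).
  by apply/measurable_EFinP; exact: indic_measurable.
have sL0 : 0 <= s * L by rewrite mulr_ge0// ltW.
apply: (@le_trans _ _ (\int[leb]_x ((s * L)%:E * (\1_K x)%:E))%E).
  have mshift : measurable_fun [set: rVn]
      (fun x : rVn => `|psi (x + s *: v)%R - psi x|%:E).
    apply: measurable_EFin_norm; apply: measurable_funB.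
      exact: C1_measurable (C1_shift (s *: v) Cpsi) measurableT.
    exact: C1_measurable Cpsi measurableT.
  apply: (@ge0_le_integral _ _ _ leb _ measurableT _ _ _ mshift).
  - by move=> x _; rewrite lee_fin.
  - exact: emeasurable_funM (measurable_cst _) mK1.
  - move=> x _; rewrite -EFinM lee_fin indicE.
    have [xK|xK] := boolP (x \in K).
      by rewrite mulr1; exact: C1_line_lipschitz.
    have Mx : M + 1 < `|x| by rewrite ltNge; apply: contra xK => ?; rewrite inE.
    rewrite mulr0 !psi0 ?subrr ?normr0//; first by apply: lt_trans Mx; rewrite ltrDl.
    have := ler_normB (x + s *: v) (s *: v); rewrite addrK normrZ (ger0_norm s0).
    move=> xle; have sv : s * `|v| <= 1 by rewrite mulr_ile1.
    by lra.
rewrite ge0_integralZl ?lee_fin//.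
rewrite integral_indic// setIT; apply: (@le_trans _ _ ((s * L)%:E * k%:E)%E).
  by apply: lee_wpmul2l => //; rewrite lee_fin.
by rewrite -EFinM lee_fin -mulrA -ler_pdivlMr.
Qed.

End shifts.

(** * Weak gradients vanish on the zero set *)

Lemma Rintegral_norm_le d (T : measurableType d) {R : realType}
    (mu : {measure set T -> \bar R}) (Q : set T) (g : T -> R) (e : R) :
  measurable Q -> mu.-integrable Q (EFin \o g) ->
  (\int[mu]_(x in Q) `|g x|%:E <= e%:E)%E -> `|\int[mu]_(x in Q) g x| <= e.
Proof.
move=> mQ ig ge; rewrite -lee_fin EFin_normr_Rintegral//.
apply: le_trans ge; exact: (le_abse_integral mu mQ (measurable_int mu ig)).
Qed.

Lemma unit_interval_dist {R : realType} (p : R) (b : bool) :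
  0 <= p <= 1 -> `|p - b%:R| <= 1.
Proof. by move=> /andP[p0 p1]; rewrite ler_norml; case: b => /=; lra. Qed.

Section weak_derivative.
Context {R : realType} {n : nat}.
Notation leb := (@lebesgue_rV R n).
Notation rVn := (lebesgue_rV_type R n).
Variables (f D : 'rV[R]_n -> R) (i : 'I_n) (c : R).
Hypothesis intf : leb.-integrable setT (EFin \o f).
Hypothesis locD : L1loc leb setT D.
Hypothesis weakD : forall phi : 'rV[R]_n -> R, C1c setT phi ->
  \int[leb]_x (f x * 'D_(delta_mx ord0 i) phi x) = - \int[leb]_x (D x * phi x).

Let e : 'rV[R]_n := delta_mx ord0 i.
Let v := c *: e.

Lemma integrableM_bounded (Q : set rVn) (g h : rVn -> R) (L : R) : measurable Q ->
  leb.-integrable Q (EFin \o g) -> measurable_fun Q h ->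
  (forall x, `|h x| <= L) -> leb.-integrable Q (EFin \o (fun x => g x * h x)).
Proof.
move=> mQ ig mh hL.
have bh : [bounded h x | x in Q].
  exists L; split; first exact: num_real.
  by move=> K LK x _ /=; exact: le_trans (hL x) (ltW LK).
by have := integrableMl mQ ig mh bh.
Qed.

(** Keeps the supports of translates under control, so that they remain test functions. *)
Lemma shift_support (psi : 'rV[R]_n -> R) (M : R) (w : 'rV[R]_n) :
  (forall x, M < `|x| -> psi x = 0) ->
  forall x, M + `|w| < `|x| -> psi (x + w) = 0.
Proof.
move=> psi0 x xM; apply: psi0.
by have := ler_normB (x + w) w; rewrite addrK; lra.
Qed.

Section convolution.
Variables (psi : 'rV[R]_n -> R) (M : R).
Hypotheses (Cpsi : C1 psi) (psi0 : forall x, M < `|x| -> psi x = 0).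

Let F (t : R) (x : rVn) : R := f x * psi (x + t *: v).

Lemma C1_support_bounded : exists2 L : R, 0 < L & forall x, `|psi x| <= L.
Proof.
have [_ cK _] := C1c_bounded_support Cpsi psi0.
apply: (continuous_bounded_support (C1_continuous Cpsi) cK) => x Nx.
by apply/eqP/negP => /negP px; apply: Nx; exact: subset_closure.
Qed.

Lemma integrable_shift (t : R) : leb.-integrable setT (EFin \o F t).
Proof.
have [L _ hL] := C1_support_bounded.
apply: (@integrableM_bounded setT f _ L measurableT intf).
  exact: C1_measurable (C1_shift (t *: v) Cpsi) measurableT.
by move=> x; exact: hL.
Qed.

(** Differentiation under the integral sign moves the derivative to psi, and the weak
gradient moves it to f: the translate of a test function is again a test function. *)
Lemma is_derive_convolution (s : R) :
  is_derive s (1 : R) (fun t : R => \int[leb]_x F t x)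
    (- c * \int[leb]_x (D x * psi (x + s *: v))).
Proof.
have [L L0 hL] := C1_support_bound v Cpsi psi0.
have dF t x : is_derive t (1 : R) (F ^~ x) (f x * 'D_v psi (x + t *: v)).
  exact: (is_deriveZ (f x) (is_derive_line x v t Cpsi)).
have sI : [set` `]s - 1, s + 1[%R] s by rewrite /= in_itv/=; apply/andP; split; lra.
have intG : leb.-integrable setT (EFin \o (fun x => `|f x| * L)).
  apply: (@integrableM_bounded setT (fun x => `|f x|) (cst L) `|L| measurableT) => //.
  exact: integrable_norm.
have G0 (x : rVn) : 0 <= `|f x| * L by rewrite mulr_ge0// ltW.
have Gub t (x : rVn) : [set` `]s - 1, s + 1[%R] t -> setT x ->
    `|partial1of2 F t x| <= `|f x| * L.
  move=> _ _; rewrite partial1of2E (@derive_val _ _ _ _ _ _ _ (dF t x)).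
  by rewrite normrM ler_wpM2l.
have der t (x : rVn) : [set` `]s - 1, s + 1[%R] t -> setT x ->
  derivable (F ^~ x) t 1 by move=> _ _; have [] := dF t x.
have intF t : [set` `]s - 1, s + 1[%R] t -> leb.-integrable setT (EFin \o F t).
  by move=> _; exact: integrable_shift.
have dG := derivable_under_integral measurableT sI intF der G0 intG Gub.
have := differentiation_under_integral measurableT sI intF der G0 intG Gub.
rewrite derive1E => DG; split => //; rewrite DG.
pose psis x := psi (x + s *: v).
have Cs : C1 psis by exact: C1_shift.
have s0 x : M + `|s *: v| < `|x| -> psis x = 0 by exact: shift_support.
have Ds x : 'D_v psi (x + s *: v) = c * 'D_e psis x.
  have -> : 'D_v psi (x + s *: v) = 'D_v psis x.
    rewrite /derive (_ : (fun h : R => _) =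
      (fun h : R => h^-1 *: (psis (h *: v + x) - psis x)))//.
    by apply/funext => h; rewrite /psis /= addrA.
  by rewrite !deriveE ?linearZ//; exact: Cs.1.
have [L' L'0 hL'] := C1_support_bound e Cs s0.
transitivity (\int[leb]_x (c * (f x * 'D_e psis x))).
  apply: eq_Rintegral => x _ /=.
  by rewrite partial1of2E (@derive_val _ _ _ _ _ _ _ (dF s x)) Ds; ring.
rewrite RintegralZl//; last first.
  exact: (integrableM_bounded measurableT intf
    (continuous_lebesgue_measurable (Cs.2 e)) hL').
by rewrite (weakD (C1c_bounded_support Cs s0)) mulrN mulNr.
Qed.

(** The mean value theorem applied to the integral of f against the translates of psi.  It
exchanges a difference of values of f, whose sign is known near the zero set, for an
integral of the weak derivative. *)
Lemma convolution_mvt (h : R) : 0 < h -> exists2 s, 0 < s < h &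
  \int[leb]_x (f x * psi (x + h *: v)) - \int[leb]_x (f x * psi x) =
  - c * (\int[leb]_x (D x * psi (x + s *: v))) * h.
Proof.
move=> h0; pose G t := \int[leb]_x F t x.
have cG : {within `[0, h], continuous G}.
  apply: continuous_subspaceT => t; apply: differentiable_continuous.
  by apply/derivable1_diffP; have [] := is_derive_convolution t.
have [s sh] := MVT h0 (fun t _ => is_derive_convolution t) cG.
rewrite subr0 => GE; exists s; first by move: sh; rewrite in_itv.
rewrite -[LHS]/(G h - _) -GE; congr (_ - _).
by apply: eq_Rintegral => x _; rewrite /F scale0r addr0.
Qed.

End convolution.
Hypothesis f_ge0 : forall x, 0 <= f x.
Hypothesis c1 : `|c| <= 1.

Lemma norm_direction_le1 : `|v| <= 1.
Proof.
rewrite normrZ mulr_ile1//; apply: mx_norm_le => // j.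
by rewrite mxE; case: (_ && _); rewrite ?normr1 ?normr0.
Qed.

(** Let psi approximate the indicator of A in L^1.  Since f is nonnegative, the translate of psi
has a nonnegative integral against f, whereas psi itself has one that is almost 0, as f
vanishes on A.  By convolution_mvt, c times the integral of D against some translate of psi by
less than tau is then at most eps.  That translate is still close to the indicator of A,
which gives the bound for A itself.

The order of the choices matters: eD comes from D and eps; an auxiliary approximation psi'
fixes tau, below which translations move psi' by little; only then is psi chosen, close enough
to the indicator of A that its integral against f is at most eps * tau. *)
Lemma weak_derivative_zero_set_sign (A : set rVn) (r : R) : measurable A ->
  (forall x, A x -> `|x| <= r) -> (forall x, A x -> f x = 0) ->
  c * \int[leb]_(x in A) D x <= 0.
Proof.
move=> mA Ar fA; have [M hM] := @C1c_approximation R n r.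
have v1 := norm_direction_le1.
have [N [MN rN]] : exists N : R, M + 1 <= N /\ r <= N.
  by exists (Num.max (M + 1) r); rewrite !le_max !lexx orbT.
pose K : set rVn := [set x : 'rV[R]_n | `|x| <= N].
have cK : compact (K : set 'rV[R]_n) by exact: compact_norm_le.
have mK : measurable K by exact: compact_lebesgue_measurable.
have iD : leb.-integrable K (EFin \o D) by apply: locD.
have AK : A `<=` K by move=> x /Ar /le_trans; apply.
have m1A (Q : set rVn) : measurable_fun Q (\1_A : rVn -> R).
  exact: indic_measurable.
apply/ler_addgt0Pl => _ /posnumP[e2]; rewrite addr0.
have [eps eps0 ->] : exists2 eps : R, 0 < eps & e2%:num = eps + eps.
  by exists (e2%:num / 2); [exact: divr_gt0|rewrite -splitr].
have [eD eD0 hD] := integral_small_weight mK iD eps0.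
have eD4 : 0 < eD / 4 by exact: divr_gt0.
have [psi' [Cpsi' psi'0 psi'01 psi'A]] := hM A _ mA Ar eD4.
have [tau /andP[tau0 tau1] htau] := shift_small Cpsi' psi'0 v1 eD4.
have et0 : 0 < eps * tau by exact: mulr_gt0.
have [ef ef0 hf] := integral_small_weight measurableT intf et0.
have em0 : 0 < Num.min ef (eD / 4) by rewrite lt_min ef0.
have [psi [Cpsi psi0 psi01 psiA]] := hM A _ mA Ar em0.
have psiAf : (\int[leb]_x `|psi x - \1_A x|%:E <= ef%:E)%E.
  by apply: le_trans psiA _; rewrite lee_fin ge_min lexx.
have psiAD : (\int[leb]_x `|psi x - \1_A x|%:E <= (eD / 4)%:E)%E.
  by apply: le_trans psiA _; rewrite lee_fin ge_min lexx orbT.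
have [s /andP[s0 st] mvt] := convolution_mvt Cpsi psi0 tau0.
have mpsi (w : 'rV[R]_n) (Q : set rVn) : measurable Q ->
    measurable_fun Q (fun x : rVn => psi (x + w)).
  exact: C1_measurable (C1_shift w Cpsi).
have mpsi' (w : 'rV[R]_n) (Q : set rVn) : measurable Q ->
    measurable_fun Q (fun x : rVn => psi' (x + w)).
  exact: C1_measurable (C1_shift w Cpsi').
have mp' (Q : set rVn) : measurable Q -> measurable_fun Q (psi' : rVn -> R).
  exact: C1_measurable Cpsi'.
have mp (Q : set rVn) : measurable Q -> measurable_fun Q (psi : rVn -> R).
  exact: C1_measurable Cpsi.
have mT := @measurableT _ rVn.
have psipsi' : (\int[leb]_x `|psi (x + s *: v)%R - psi' (x + s *: v)%R|%:E <=
    (eD / 4)%:E + (eD / 4)%:E)%E.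
  pose h (x : rVn) : \bar R := `|psi x - psi' x|%:E.
  have mh : measurable_fun setT h.
    by apply: measurable_EFin_norm; apply: measurable_funB; [exact: mp|exact: mp'].
  rewrite [leLHS](ge0_integral_shift (s *: v) mh) => [|x]; last by rewrite lee_fin.
  apply: le_trans (leeD psiAD psi'A).
  have m1 : measurable_fun [set: rVn] (fun x => psi x - psi' x).
    by apply: measurable_funB; [exact: mp|exact: mp'].
  have m2 : measurable_fun [set: rVn] (fun x => psi x - \1_A x).
    by apply: measurable_funB; [exact: mp|exact: m1A].
  have m3 : measurable_fun [set: rVn] (fun x => psi' x - \1_A x).
    by apply: measurable_funB; [exact: mp'|exact: m1A].
  apply: (le_integral_normD leb mT m1 m2 m3) => x _.
  by rewrite (distrC (psi' x)) (le_trans _ (ler_normD _ _))// addrA subrK.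
pose u (x : rVn) := psi (x + s *: v) - \1_A x.
have mu_ (Q : set rVn) : measurable Q -> measurable_fun Q u.
  by move=> mQ; apply: measurable_funB; [exact: mpsi|exact: m1A].
have uD : (\int[leb]_x `|u x|%:E <= eD%:E)%E.
  have m1 : measurable_fun [set: rVn]
      (fun x => psi (x + s *: v) - psi' (x + s *: v)).
    by apply: measurable_funB; [exact: mpsi|exact: mpsi'].
  have m2 : measurable_fun [set: rVn] (fun x => psi' (x + s *: v) - \1_A x).
    by apply: measurable_funB; [exact: mpsi'|exact: m1A].
  have m3 : measurable_fun [set: rVn] (fun x => psi' (x + s *: v) - psi' x).
    by apply: measurable_funB; [exact: mpsi'|exact: mp'].
  have m4 : measurable_fun [set: rVn] (fun x => psi' x - \1_A x).
    by apply: measurable_funB; [exact: mp'|exact: m1A].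
  have hs := htau s (ltac:(by rewrite (ltW s0) (ltW st))).
  have uD' := leeD psipsi' (leeD hs psi'A).
  rewrite (_ : eD = eD / 4 + eD / 4 + (eD / 4 + eD / 4)); last by field.
  rewrite !EFinD; apply: le_trans uD'.
  apply: (@le_trans _ _ (\int[leb]_x `|psi (x + s *: v)%R - psi' (x + s *: v)%R|%:E +
    \int[leb]_x `|psi' (x + s *: v)%R - \1_A x|%:E)%E).
    apply: (le_integral_normD leb mT (mu_ _ mT) m1 m2) => x _.
    by rewrite (le_trans _ (ler_normD _ _))// addrA subrK.
  rewrite leeD2l//; apply: (le_integral_normD leb mT m2 m3 m4) => x _.
  by rewrite (le_trans _ (ler_normD _ _))// addrA subrK.
have u1 (x : rVn) : `|u x| <= 1.
  by rewrite /u indicE; exact: unit_interval_dist.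
have iDu : leb.-integrable K (EFin \o (fun x => D x * u x)).
  exact: (integrableM_bounded mK iD (mu_ K mK) u1).
have Du : `|\int[leb]_(x in K) (D x * u x)| <= eps.
  apply: (Rintegral_norm_le mK iDu); apply: (hD u (mu_ K mK) (fun x _ => u1 x)).
  apply: le_trans uD; apply: (@ge0_subset_integral _ _ _ leb _ _ mK mT).
  - exact: measurable_EFin_norm (mu_ _ mT).
  - by move=> x _; rewrite lee_fin.
  - exact: subsetT.
have ind01 (x : rVn) : `|(\1_A x : R)| <= 1.
  by rewrite indicE; case: (_ \in _); rewrite ?normr1 ?normr0.
have p1 (x : rVn) : `|psi x - \1_A x| <= 1.
  by rewrite indicE; exact: unit_interval_dist.
have mpA : measurable_fun [set: rVn] (fun x => psi x - \1_A x).
  by apply: measurable_funB; [exact: mp|exact: m1A].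
(* f vanishes on A, so f integrated against psi only sees psi - 1_A *)
have fpsi : \int[leb]_x (f x * psi x) <= eps * tau.
  rewrite (_ : \int[leb]_x _ = \int[leb]_x (f x * (psi x - \1_A x))); last first.
    apply: eq_Rintegral => x _; rewrite indicE.
    have [xA|_] := boolP (x \in A); last by rewrite subr0.
    by rewrite fA ?mul0r//; exact: set_mem.
  apply: le_trans (ler_norm _) _.
  apply: (Rintegral_norm_le mT); last exact: hf.
  exact: (integrableM_bounded mT intf mpA p1).
have fpsi_ge0 : 0 <= \int[leb]_x (f x * psi (x + tau *: v)).
  apply: Rintegral_ge0 => x _; apply: mulr_ge0 => //.
  by have /andP[] := psi01 (x + tau *: v).
have Dpsi : c * (\int[leb]_x (D x * psi (x + s *: v))) <= eps.
  rewrite -(ler_pM2r tau0); apply: le_trans fpsi.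
  by rewrite -[leLHS]opprK -[- (c * _ * tau)]mulNr -[- (c * _)]mulNr -mvt opprB gerBl.
have DpsiK : \int[leb]_x (D x * psi (x + s *: v)) =
    \int[leb]_(x in K) (D x * psi (x + s *: v)).
  rewrite [RHS]Rintegral_mkcond; apply: eq_Rintegral => x _.
  rewrite patchE; case: ifPn => // /negP Kx.
  have xN : N < `|x| by rewrite ltNge; apply/negP => xN; apply: Kx; rewrite inE.
  rewrite (shift_support psi0) ?mulr0//; apply: le_lt_trans xN.
  rewrite (le_trans _ MN)// lerD2l normrZ (gtr0_norm s0).
  by rewrite mulr_ile1// ltW// (lt_le_trans st).
have DA : \int[leb]_(x in A) D x = \int[leb]_(x in K) (D x * \1_A x).
  rewrite Rintegral_mkcond [RHS]Rintegral_mkcond; apply: eq_Rintegral => x _.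
  rewrite !patchE indicE; have [xA|xA] := boolP (x \in A).
    by rewrite mem_set ?mulr1//; apply: AK; exact: set_mem.
  by case: ifP; rewrite ?mulr0.
have DE : \int[leb]_(x in K) (D x * u x) =
    \int[leb]_(x in K) (D x * psi (x + s *: v)) - \int[leb]_(x in A) D x.
  rewrite DA -RintegralB//.
  - by apply: eq_Rintegral => x _; rewrite /u mulrBr.
  - apply: (integrableM_bounded mK iD (mpsi _ _ mK) (L := 1)) => x.
    by have /andP[p0' p1'] := psi01 (x + s *: v); rewrite ger0_norm.
  - exact: (integrableM_bounded mK iD (m1A K) ind01).
rewrite (_ : \int[leb]_(x in A) D x = \int[leb]_(x in K) (D x * psi (x + s *: v))
  - \int[leb]_(x in K) (D x * u x)); last by rewrite DE opprB addrC subrK.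
rewrite -DpsiK mulrBr; apply: lerD => //.
rewrite -mulrN; apply: le_trans (ler_norm _) _.
by rewrite normrM normrN (le_trans (ler_piMl _ c1)).
Qed.

End weak_derivative.

(** Both signs c = 1 and c = -1 are allowed in weak_derivative_zero_set_sign, so the weak
derivative has integral 0 over every bounded measurable part of the zero set. *)
Lemma weak_grad_zero_set {R : realType} {n : nat} (f : 'rV[R]_n -> R)
    (Df : 'rV[R]_n -> 'rV[R]_n) :
  lebesgue_rV.-integrable setT (EFin \o f) -> (forall x, 0 <= f x) ->
  is_weak_grad f Df ->
  forall i, {ae (@lebesgue_rV R n), forall x, f x = 0 -> Df x ord0 i = 0}.
Proof.
move=> intf f0 wD i; have [locD weakD] := wD i.
pose D (x : 'rV[R]_n) := Df x ord0 i.
have mf : measurable_fun [set: lebesgue_rV_type R n] f.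
  by apply/measurable_EFinP; exact: measurable_int intf.
pose K (k : nat) : set 'rV[R]_n := [set x | `|x| <= k%:R].
have cK k : compact (K k) by exact: compact_norm_le.
pose Q k : set (lebesgue_rV_type R n) := K k `&` (f @^-1` [set 0]).
have mQ k : measurable (Q k).
  apply: measurableI; first exact: compact_lebesgue_measurable.
  by rewrite -[X in measurable X]setTI; exact: mf.
have iD k : lebesgue_rV.-integrable (Q k) (EFin \o D).
  apply: (@integrableS _ _ _ lebesgue_rV (K k)).
  - exact: compact_lebesgue_measurable.
  - exact: mQ.
  - exact: subIsetl.
  - exact: (locD (K k) (cK k) (@subsetT _ _)).
have aeQ k : ae_eq lebesgue_rV (Q k) (EFin \o D) (cst 0%E).
  apply: (integral_ae_eq (mQ k) (iD k)) => // E EQ mE.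
  rewrite integral0; have iDE : lebesgue_rV.-integrable E (EFin \o D).
    exact: (integrableS (mQ k) mE EQ (iD k)).
  have EK x : E x -> `|x| <= k%:R by move=> /EQ[].
  have Ef x : E x -> f x = 0 by move=> /EQ[].
  have := @weak_derivative_zero_set_sign _ _ f D i (-1) intf locD weakD f0 _ E _ mE EK Ef.
  have := @weak_derivative_zero_set_sign _ _ f D i 1 intf locD weakD f0 _ E _ mE EK Ef.
  rewrite normrN normr1 lexx mul1r mulN1r oppr_le0 => /(_ isT) le0 /(_ isT) ge0.
  have E0 : (\int[lebesgue_rV]_(x in E) D x)%R = 0.
    by apply/eqP; rewrite eq_le le0 ge0.
  rewrite -[LHS]fineK; last exact: integrable_fin_num.
  by congr (_%:E).
have := ae_foralln aeQ; apply: filterS => x xQ fx0.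
have [k _ xk] : exists2 k : nat, True & `|x| <= k%:R.
  by exists (Num.Def.archi_bound `|x|) => //; exact/ltW/archi_boundP.
by have [] := xQ k (conj xk fx0).
Qed.

(** * Integration against a measure with a density *)

Section density_measure.
Context d (T : measurableType d) {R : realType}.
Variables (nu mu : {measure set T -> \bar R}) (f : T -> R).
Hypothesis f_ge0 : forall x, 0 <= f x.
Hypothesis mf : measurable_fun setT f.
Hypothesis muE : forall A, measurable A ->
  mu A = (\int[nu]_(x in A) (f x)%:E)%E.

Import HBNNSimple.

Lemma integral_density_nnsfun (h : {nnsfun T >-> R}) :
  (\int[mu]_x (h x)%:E = \int[nu]_x ((h x)%:E * (f x)%:E))%E.
Proof.
have mfE : measurable_fun setT (EFin \o f) by exact/measurable_EFinP.
have mA y : measurable (h @^-1` [set y]) by exact: measurable_funPTI.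
have mi y : measurable_fun setT (fun x => (\1_(h @^-1` [set y]) x)%:E : \bar R).
  by apply/measurable_EFinP; exact: measurable_indic.
have myi y : measurable_fun setT (fun x => (y * \1_(h @^-1` [set y]) x)%:E : \bar R).
  by apply/measurable_EFinP; apply: measurable_funM.
rewrite integralT_nnsfun sintegralE.
rewrite [RHS](eq_integral (fun x => \sum_(y \in range h)
    ((y * \1_(h @^-1` [set y]) x)%:E * (f x)%:E)))%E; last first.
  move=> x _; rewrite -ge0_mule_fsuml; last first.
    by move=> y; rewrite EFinM; exact: nnfun_muleindic_ge0.
  by rewrite fsumEFin// -(fimfunE h x).
rewrite ge0_integral_fsum//; last 2 first.
- by move=> y; exact: emeasurable_funM (myi y) mfE.
- move=> y x _; apply: mule_ge0; last by rewrite lee_fin.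
  by rewrite EFinM; exact: nnfun_muleindic_ge0.
apply: eq_fsbigr => y /set_mem [t _ ty].
have y0 : (0 <= y%:E)%E by rewrite -ty lee_fin.
rewrite muE//; under [RHS]eq_integral do rewrite EFinM -muleA.
rewrite ge0_integralZl//; last 2 first.
- exact: emeasurable_funM (mi y) mfE.
- by move=> x _; rewrite mule_ge0// lee_fin.
congr (_ * _)%E; rewrite integral_mkcond; apply: eq_integral => x _.
rewrite patchE indicE; case: ifP => _; by rewrite ?mul1e ?mul0e.
Qed.

(** Monotone convergence from the simple functions. *)
Lemma ge0_integral_density (D : set T) (h : T -> \bar R) : measurable D ->
  measurable_fun D h -> (forall x, D x -> (0 <= h x)%E) ->
  (\int[mu]_(x in D) h x = \int[nu]_(x in D) (h x * (f x)%:E))%E.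
Proof.
move=> mD mh h0; rewrite integral_mkcond [RHS]integral_mkcond.
pose hD := (h \_ D)%E.
have mhD : measurable_fun setT hD by exact/(measurable_restrictT _ _).1.
have hD0 x : (0 <= hD x)%E by apply: erestrict_ge0.
rewrite [RHS](eq_integral (fun x => hD x * (f x)%:E)%E); last first.
  by move=> x _; rewrite /hD !patchE; case: ifP => // _; rewrite mul0e.
pose a := nnsfun_approx measurableT mhD.
have a_cvg x : (a m x)%:E @[m --> \oo] --> hD x.
  by apply: cvg_nnsfun_approx => // *; exact: hD0.
have a_nd x m m' : (m <= m')%N -> ((a m x)%:E <= (a m' x)%:E)%E.
  by move=> mm'; rewrite lee_fin; exact/lefP/nd_nnsfun_approx.
have am m : measurable_fun setT (EFin \o a m) by exact/measurable_EFinP.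
have cvgmu : (\int[mu]_x (a m x)%:E)%E @[m --> \oo] --> (\int[mu]_x hD x)%E.
  rewrite (_ : \int[mu]_x hD x = \int[mu]_x (limn (fun m => (a m x)%:E)))%E.
    apply: cvg_monotone_convergence => //.
    - by move=> m x _; rewrite lee_fin.
    - by move=> x _ m m'; exact: a_nd.
  by apply: eq_integral => x _; apply/esym/cvg_lim.
have mfE : measurable_fun setT (EFin \o f) by exact/measurable_EFinP.
have f0 x : (0 <= (f x)%:E)%E by rewrite lee_fin.
have cvgnu : (\int[nu]_x ((a m x)%:E * (f x)%:E))%E @[m --> \oo] -->
    (\int[nu]_x (hD x * (f x)%:E))%E.
  rewrite (_ : \int[nu]_x (hD x * (f x)%:E) =
      \int[nu]_x (limn (fun m => (a m x)%:E * (f x)%:E)))%E.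
    apply: cvg_monotone_convergence => //.
    - by move=> m; exact: emeasurable_funM (am m) mfE.
    - by move=> m x _; rewrite mule_ge0// lee_fin.
    - by move=> x _ m m' mm'; rewrite lee_wpmul2r//; exact: a_nd.
  apply: eq_integral => x _; apply/esym/cvg_lim => //.
  by apply: cvgeZr => //; exact: a_cvg.
rewrite -(cvg_lim _ cvgmu)// -(cvg_lim _ cvgnu)//; congr (limn _).
by apply/funext => m; exact: integral_density_nnsfun.
Qed.

End density_measure.

(** * Convergence of integrals weighted by f and by E *)

Section weighted_convergence.
Context d (T : measurableType d) {R : realType}.
Variables (nu : {measure set T -> \bar R}) (K : set T).
Hypothesis mK : measurable K.
Variables (f E : T -> R).
Hypotheses (f_ge0 : forall x, 0 <= f x) (mf : measurable_fun K f).
Hypotheses (iE : nu.-integrable K (EFin \o E))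
  (fE : forall x, f x = 0 -> E x = 0).

Lemma integrable_bounded_mul (M : R) (b : T -> R) : measurable_fun K b ->
  (forall x, `|b x| <= M) -> nu.-integrable K (EFin \o (fun x => b x * E x)).
Proof.
move=> mb bM; have bb : [bounded b x | x in K].
  exists M; split; first exact: num_real.
  by move=> L ML x _ /=; exact: le_trans (bM x) (ltW ML).
by have := integrableMr mK mb bb iE.
Qed.

(** The measure with density E is absolutely continuous with respect to the one with density
f, because E vanishes with f.  Quantitatively, where E is at most m f in absolute value, the
integral against E is at most m times the integral against f; the rest has a small integral
of E, and there the bound M on b is used. *)
Lemma weighted_small (M e : R) : 0 < M -> 0 < e ->
  exists2 delta : R, 0 < delta & forall b : T -> R, measurable_fun K b ->
    (forall x, `|b x| <= M) ->
    (\int[nu]_(x in K) `|b x * f x|%:E <= delta%:E)%E ->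
    (\int[nu]_(x in K) `|b x * E x|%:E <= e%:E)%E.
Proof.
move=> M0 e0; have e2 : 0 < e / 2 by lra.
have mE : measurable_fun K E by apply/measurable_EFinP; exact: measurable_int iE.
pose tail (m : nat) x := if m%:R * f x < `|E x| then E x else 0.
have mtail m : measurable_fun K (tail m).
  apply: measurable_fun_if => //.
    apply: measurable_fun_ltr; last exact: measurableT_comp.
    by apply: measurable_funM => //; exact: measurable_cst.
  exact: (measurable_funS mK (@subIsetl _ _ _) mE).
have inE : nu.-integrable K (EFin \o (fun x => `|E x|)).
  exact: integrable_norm.
have eM : 0 < e / 2 / M by exact: divr_gt0.
have [m hm] : exists m, (\int[nu]_(x in K) `|tail m x|%:E <= (e / 2 / M)%:E)%E.
  apply: (dominated_small mK mtail inE _ _ eM).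
    by move=> m x _; rewrite /tail; case: ifP => _ //; rewrite normr0.
  move=> x _; apply: cvg_near_cst; rewrite /tail.
  have [fx0|fx0] := eqVneq (f x) 0.
    by apply: nearW => m; rewrite fx0 mulr0 fE// normr0 ltxx.
  have fx : 0 < f x by rewrite lt_def fx0 f_ge0.
  near=> m; rewrite ltNge -ler_pdivrMr//.
  suff -> : `|E x| / f x <= m%:R by [].
  by near: m; exact: nbhs_infty_ger.
have m1 : 0 < m%:R + 1 :> R by rewrite ltr_wpDl.
exists (e / 2 / (m%:R + 1)); first exact: divr_gt0.
move=> b mb bM ble.
have mbE : measurable_fun K (fun x => b x * E x) by exact: measurable_funM.
have mbf : measurable_fun K (fun x => b x * f x) by exact: measurable_funM.
have mmb : measurable_fun K (fun x => (m%:R + 1) * (b x * f x)).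
  by apply: measurable_funM => //; exact: measurable_cst.
have mMt : measurable_fun K (fun x => M * tail m x).
  by apply: measurable_funM => //; exact: measurable_cst.
have scale (c r : R) (h : T -> R) : 0 < c -> measurable_fun K h ->
    (\int[nu]_(x in K) `|h x|%:E <= (r / c)%:E)%E ->
    (\int[nu]_(x in K) `|c * h x|%:E <= r%:E)%E.
  move=> c0 mh hr; under eq_integral do rewrite normrM (ger0_norm (ltW c0)) EFinM.
  rewrite ge0_integralZl// ?lee_fin ?(ltW c0)//; last exact: measurable_EFin_norm.
  apply: (@le_trans _ _ (c%:E * (r / c)%:E)%E).
    by apply: lee_wpmul2l => //; rewrite lee_fin ltW.
  by rewrite -EFinM mulrC divfK// gt_eqF.
rewrite [e]splitr EFinD.
apply: le_trans (leeD (scale _ _ _ M0 (mtail m) hm) (scale _ _ _ m1 mbf ble)).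
apply: (le_integral_normD nu mK mbE mMt mmb) => x _.
rewrite /tail !normrM (ger0_norm (ltW m1)) (ger0_norm (ltW M0)).
case: ltP => gm.
  by rewrite ler_wpDr ?mulr_ge0 ?(ltW m1)// ler_wpM2r.
rewrite normr0 mulr0 add0r mulrCA ler_wpM2l// (le_trans gm)//.
by rewrite (ger0_norm (f_ge0 x)) ler_wpM2r// lerDl.
Unshelve. all: by end_near. Qed.

Lemma cvg_integral_bounded_weight (M : R) (b_ : nat -> T -> R) (b : T -> R) :
  (forall k, measurable_fun K (b_ k)) -> measurable_fun K b ->
  (forall k x, `|b_ k x| <= M) -> (forall x, `|b x| <= M) ->
  (\int[nu]_(x in K) `|(b_ k x - b x) * f x|%:E)%E @[k --> \oo] --> 0%E ->
  (\int[nu]_(x in K) (b_ k x * E x)%:E)%E @[k --> \oo] -->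
  (\int[nu]_(x in K) (b x * E x)%:E)%E.
Proof.
move=> mb_ mb b_M bM cv.
have ib_ k := integrable_bounded_mul (mb_ k) (b_M k).
have ib := integrable_bounded_mul mb bM.
have M2 : 0 < 2 * `|M| + 1 by rewrite ltr_wpDl// mulr_ge0.
have dM k x : `|b_ k x - b x| <= 2 * `|M| + 1.
  have := ler_normB (b_ k x) (b x); have := b_M k x; have := bM x.
  by have := ler_norm M; lra.
have mdb k : measurable_fun K (fun x => b_ k x - b x) by exact: measurable_funB.
suff cvR : (\int[nu]_(x in K) (b_ k x * E x))%R @[k --> \oo] -->
    (\int[nu]_(x in K) (b x * E x))%R.
  have fineE (g : T -> R) : nu.-integrable K (EFin \o g) ->
      (\int[nu]_(x in K) (g x)%:E)%E = (\int[nu]_(x in K) g x)%R%:E.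
    by move=> ig; rewrite /Rintegral fineK//; exact: integrable_fin_num.
  rewrite (fineE _ ib) (_ : (fun k => _) =
    (fun k => ((\int[nu]_(x in K) (b_ k x * E x))%R)%:E)); last first.
    by apply/funext => k; exact: fineE (ib_ k).
  by apply: cvg_EFin => //; exact: nearW.
apply/cvgrPdist_le => e e0; have [delta d0 hd] := weighted_small M2 e0.
have nb : nbhs (0%E : \bar R) [set y | (y < delta%:E)%E].
  by apply: open_ereal_lt'; rewrite lte_fin.
have near_small : \forall k \near \oo,
  (\int[nu]_(x in K) `|(b_ k x - b x) * f x|%:E < delta%:E)%E := cv _ nb.
near=> k; have /ltW small : (\int[nu]_(x in K)
  `|(b_ k x - b x) * f x|%:E < delta%:E)%E by near: k.
rewrite distrC -RintegralB//.
rewrite (_ : \int[nu]_(x in K) _ = \int[nu]_(x in K) ((b_ k x - b x) * E x)).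
  apply: (Rintegral_norm_le mK (integrable_bounded_mul (mdb k) (dM k))).
  exact: hd (mdb k) (dM k) small.
by apply: eq_Rintegral => x _; rewrite mulrBl.
Unshelve. all: by end_near. Qed.

End weighted_convergence.

(** * Truncation *)

Section clip.
Context {R : realType}.
Implicit Types (a b M : R).

Definition clip M b : R := Num.max (- M) (Num.min M b).

Lemma clip_norm_le M b : 0 <= M -> `|clip M b| <= M.
Proof.
move=> M0; rewrite ler_norml /clip le_max lexx/= ge_max ge_min lexx.
by rewrite (le_trans _ M0)// oppr_le0.
Qed.

Lemma clip_id M b : `|b| <= M -> clip M b = b.
Proof. by rewrite ler_norml /clip => /andP[b1 b2]; rewrite min_r// max_r. Qed.

Lemma max_lipschitz a b c : `|Num.max c a - Num.max c b| <= `|a - b|.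
Proof.
have := ler_norm (a - b); have := ler_norm (b - a); rewrite (distrC b a) => h1 h2.
by rewrite ler_norml; case: (leP c a) => ?; case: (leP c b) => ?; apply/andP; split; lra.
Qed.

Lemma min_lipschitz a b c : `|Num.min c a - Num.min c b| <= `|a - b|.
Proof.
have := ler_norm (a - b); have := ler_norm (b - a); rewrite (distrC b a) => h1 h2.
by rewrite ler_norml; case: (leP c a) => ?; case: (leP c b) => ?; apply/andP; split; lra.
Qed.

Lemma clip_lipschitz M a b : `|clip M a - clip M b| <= `|a - b|.
Proof. exact: le_trans (max_lipschitz _ _ _) (min_lipschitz _ _ _). Qed.

(** The truncation of b at a level that bounds a is at least as close to b as a is; hence
the limit of functions bounded by M is bounded by M almost everywhere for the weight. *)
Lemma clip_dist_le M a b : `|a| <= M -> `|b - clip M b| <= `|a - b|.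
Proof.
rewrite ler_norml => /andP[a1 a2]; rewrite /clip.
have := ler_norm (a - b); have := ler_norm (b - a); rewrite (distrC b a) => h1 h2.
have M0 : - M <= M by lra.
rewrite ler_norml; case: (leP M b) => ?.
  by rewrite max_r//; apply/andP; split; lra.
by case: (leP (- M) b) => ?; apply/andP; split; lra.
Qed.

Lemma measurable_clip d (T : measurableType d) (D : set T) M (b : T -> R) :
  measurable_fun D b -> measurable_fun D (fun x => clip M (b x)).
Proof.
move=> mb; apply: measurable_maxr; first exact: measurable_cst.
by apply: measurable_minr => //; exact: measurable_cst.
Qed.

End clip.

Lemma le_limn_einf {R : realType} (u v : (\bar R)^nat) :
  (forall k, (u k <= v k)%E) -> (limn_einf u <= limn_einf v)%E.
Proof.
move=> uv; rewrite !limn_einf_lim; apply: lee_lim.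
- exact: is_cvg_einfs.
- exact: is_cvg_einfs.
apply: nearW => k; apply: le_ereal_inf_tmp => _ [m km <-].
by apply: le_trans (uv m); apply: ereal_inf_lbound; exists m.
Qed.

Lemma Linfty_norm_ae {R : realType} {n : nat} (U : set 'rV[R]_n)
    (g : 'rV[R]_n -> R) (M : R) : (Linfty_norm U g <= M%:E)%E ->
  {ae (@lebesgue_rV R n), forall x, U x -> `|g x| <= M}.
Proof.
rewrite /Linfty_norm unlock /Lnorm lebesgue_rV_setT_gt0 => /ess_supP.
apply: filterS => x /=; rewrite patchE => gM Ux.
by move: gM; rewrite mem_set.
Qed.

(** * The integrand attached to a test field *)

Section test_field.
Context {R : realType} {n : nat}.
Notation leb := (@lebesgue_rV R n).
Notation rVn := (lebesgue_rV_type R n).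
Variables (f : 'rV[R]_n -> R) (Df : 'rV[R]_n -> 'rV[R]_n).
Hypothesis intf : leb.-integrable setT (EFin \o f).
Hypothesis wD : is_weak_grad f Df.
Variables (U : set 'rV[R]_n) (phi : 'rV[R]_n -> 'rV[R]_n).
Hypothesis Cphi : C1c U phi.

Let K := closure [set x | phi x != 0].
(** The density that a test field phi pairs with g in the definition of BVnorm; it is the
divergence of f phi. *)
Definition weighted_div x := divergence phi x * f x + dotrV (phi x) (Df x).

Lemma weighted_div_out x : ~ K x -> weighted_div x = 0.
Proof.
move=> Kx; rewrite /weighted_div /divergence big1 ?mul0r ?add0r => [|i _].
  rewrite /dotrV big1// => i _; suff -> : phi x = 0 by rewrite mxE mul0r.
  by apply/eqP/negP => /negP px; apply: Kx; exact: subset_closure.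
by rewrite derive_out_support// mxE.
Qed.

Lemma coord_bounded_integrable (h : 'rV[R]_n -> 'rV[R]_n) (i : 'I_n)
    (g : 'rV[R]_n -> R) : continuous h -> (forall x, ~ K x -> h x = 0) ->
  leb.-integrable K (EFin \o g) ->
  leb.-integrable K (EFin \o (fun x => g x * h x ord0 i)).
Proof.
move=> ch h0 ig; have [_ cK _] := Cphi.
have [L _ hL] := continuous_bounded_support ch cK h0.
have mK : measurable (K : set rVn) by exact: compact_lebesgue_measurable.
have chi : continuous (fun x => h x ord0 i).
  move=> x; exact: (continuous_comp (ch x) (@coord_continuous _ _ _ ord0 i (h x))).
apply: (integrableM_bounded mK ig _ (fun x => le_trans (mx_norm_coord_le (h x) i) (hL x))).
exact: (measurable_funS measurableT (@subsetT _ _) (continuous_lebesgue_measurable chi)).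
Qed.

Lemma integrable_weighted_div : leb.-integrable K (EFin \o weighted_div).
Proof.
have [[dphi cphi] cK _] := Cphi.
have mK : measurable (K : set rVn) by exact: compact_lebesgue_measurable.
have iK : leb.-integrable K (EFin \o f).
  exact: (integrableS measurableT mK (@subsetT _ _) intf).
have i1 : leb.-integrable K (fun x => \sum_(i < n)
    (f x * ('D_(delta_mx ord0 i) phi x) ord0 i)%:E)%E.
  apply: integrable_sum => // i _.
  apply: (coord_bounded_integrable i (cphi _) _ iK) => x.
  exact: derive_out_support.
have i2 : leb.-integrable K (fun x => \sum_(i < n)
    (Df x ord0 i * phi x ord0 i)%:E)%E.
  apply: integrable_sum => // i _; have [locD _] := wD i.
  apply: (coord_bounded_integrable i _ _ (locD K cK (@subsetT _ _))).
    by move=> x; exact: differentiable_continuous.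
  by move=> x Kx; apply/eqP/negP => /negP px; apply: Kx; exact: subset_closure.
have := integrableD mK i1 i2; congr (integrable _ _ _); apply/funext => x /=.
rewrite !sumEFin -EFinD; congr (_%:E); rewrite /weighted_div; congr (_ + _).
  by rewrite /divergence mulr_suml; apply: eq_bigr => i _; rewrite mulrC.
by apply: eq_bigr => i _; rewrite mulrC.
Qed.

(** The first term has the factor f, and the weak gradient vanishes almost everywhere on
the zero set. *)
Lemma weighted_div_zero_set : (forall x, 0 <= f x) ->
  {ae leb, forall x, f x = 0 -> weighted_div x = 0}.
Proof.
move=> f0; have aeD := weak_grad_zero_set intf f0 wD.
have aeF : Filter (almost_everywhere leb) by exact: ae_filter_ringOfSetsType.
apply: filterS (filter_forall aeF aeD) => x Dx fx.
rewrite /weighted_div fx mulr0 add0r /dotrV big1// => i _.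
by rewrite Dx// mulr0.
Qed.

End test_field.

(** * Lower semicontinuity *)

Theorem lemma2p3 (R : realType) (n : nat)
    (mu : {measure set (lebesgue_rV_type R n) -> \bar R})
    (f : 'rV[R]_n -> R) (mu_f : scrW mu f)
    (U : set 'rV[R]_n) (openU : open U)
    (g_ : nat -> 'rV[R]_n -> R) (BVg_ : forall k, BV f U (g_ k))
    (bounded_g_ : (ereal_sup (range (fun k => Linfty_norm U (g_ k))) < +oo)%E)
    (g : 'rV[R]_n -> R) (L1g : L1loc mu U g) (cvg_g_ : L1loc_cvg mu U g_ g) :
  (BVnorm f U g <= limn_einf (fun k => BVnorm f U (g_ k)))%E.
Proof.
have [muE f_ge0 intf [_ exDf] _] := mu_f.
pose leb := @lebesgue_rV R n; pose rVn := lebesgue_rV_type R n.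
have aeF : Filter (almost_everywhere leb) by exact: ae_filter_ringOfSetsType.
pose Df := weak_grad f.
have wD : is_weak_grad f Df := xgetPex (fun=> 0) exDf.
have mf : measurable_fun [set: rVn] f.
  by apply/measurable_EFinP; exact: measurable_int intf.
have [M [M0 g_M]] : exists M : R, 0 <= M /\
    forall k, {ae leb, forall x, U x -> `|g_ k x| <= M}.
  set S := ereal_sup _ in bounded_g_.
  have leS k : (Linfty_norm U (g_ k) <= S)%E by apply: ereal_sup_ubound; exists k.
  have S0 : (0 <= S)%E by apply: le_trans (leS 0%N); exact: Lnorm_ge0.
  have SE : S = (fine S)%:E by rewrite fineK// ge0_fin_numE.
  exists (fine S); split; first exact: fine_ge0.
  by move=> k; apply: Linfty_norm_ae; rewrite -SE.
apply: ge_ereal_sup => _ [phi [Cphi phi1] <-].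
pose K : set rVn := closure [set x | phi x != 0].
have [_ cK KU] := Cphi.
have mK : measurable K by exact: compact_lebesgue_measurable.
have mU : measurable (U : set rVn) by exact: open_lebesgue_measurable.
pose E0 := weighted_div f Df phi.
have mfK : measurable_fun K f := measurable_funS measurableT (@subsetT _ _) mf.
have iE0 : leb.-integrable K (EFin \o E0) := integrable_weighted_div intf wD Cphi.
have mE0 : measurable_fun K E0.
  by apply/measurable_EFinP; exact: (measurable_int _ iE0).
pose E (x : rVn) := if 0 < f x then E0 x else 0.
have mE : measurable_fun K E.
  have mpos : measurable_fun K (fun x => 0 < f x).
    exact: measurable_fun_ltr (measurable_cst _) mfK.
  apply: (measurable_fun_if mK mpos _ (measurable_cst _)).
  exact: (measurable_funS mK (@subIsetl _ _ _) mE0).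
have iE : leb.-integrable K (EFin \o E).
  apply: (le_integrable mK _ _ iE0); first exact/measurable_EFinP.
  by move=> x _; rewrite /= /E lee_fin; case: ifP => // _; rewrite normr0.
have fE x : f x = 0 -> E x = 0 by move=> fx; rewrite /E fx ltxx.
have E0E : {ae leb, forall x, E0 x = E x}.
  have aeE := weighted_div_zero_set intf wD phi f_ge0.
  apply: filterS aeE => x E0x.
  rewrite /E lt_def f_ge0 andbT; have [fx|//] := eqVneq (f x) 0.
  exact: E0x.
have mg_ k : measurable_fun K (g_ k : rVn -> R).
  exact: (measurable_funS mU KU (BVg_ k).1).
have mg : measurable_fun K (g : rVn -> R).
  by apply/measurable_EFinP; exact: (measurable_int _ (L1g K cK KU)).
(* The integrand vanishes off K, and E0 vanishes almost everywhere on {f = 0},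
   so only the values of h on K where f > 0 count. *)
have reduce (h : 'rV[R]_n -> R) : measurable_fun K (h : rVn -> R) ->
    {ae leb, forall x, K x -> 0 < f x -> clip M (h x) = h x} ->
    (\int[leb]_(x in U) (h x * (divergence phi x * f x + dotrV (phi x) (weak_grad f x)))%:E
    = \int[leb]_(x in K) (clip M (h x) * E x)%:E)%E.
  move=> mh hM.
  transitivity (\int[leb]_(x in K) (h x * E0 x)%:E)%E.
    rewrite integral_mkcond [RHS]integral_mkcond; apply: eq_integral => x _.
    rewrite !patchE; have [xK|xK] := boolP (x \in K).
      by rewrite (mem_set (KU _ (set_mem xK))).
    case: ifP => // _; rewrite -[divergence _ _ * _ + _]/(E0 x).
    rewrite /E0 (weighted_div_out _ _ (phi := phi)) ?mulr0//.
    by move=> Kx; move/negP: xK; apply; rewrite inE.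
  apply: (@ae_eq_integral _ _ _ lebesgue_rV K _ _ mK).
  - by apply/measurable_EFinP; exact: measurable_funM mh mE0.
  - apply/measurable_EFinP; exact: measurable_funM (measurable_clip M mh) mE.
  - apply: filterS2 E0E hM => x /= -> hx Kx; rewrite /E.
    by case: ifP => [fx|]; rewrite ?mulr0// hx.
have cvgf : (\int[leb]_(x in K) `|(g_ k x - g x) * f x|%:E)%E @[k --> \oo] --> 0%E.
  have := cvg_g_ K cK KU; apply: cvg_trans; apply: near_eq_cvg; apply: nearW => k /=.
  rewrite (@ge0_integral_density _ rVn R lebesgue_rV mu f f_ge0 mf muE K _ mK).
  - apply: eq_integral => x _; by rewrite normrM (ger0_norm (f_ge0 x)).
  - exact: measurable_EFin_norm (measurable_funB (mg_ k) mg).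
  - by move=> x _; rewrite lee_fin.
have mc_ k := measurable_clip M (mg_ k).
have mc := measurable_clip M mg.
have gM : {ae leb, forall x, K x -> 0 < f x -> clip M (g x) = g x}.
  pose h (x : rVn) := (g x - clip M (g x)) * f x.
  have mh : measurable_fun K h.
    exact: measurable_funM (measurable_funB mg mc) mfK.
  have h_le k : (\int[leb]_(x in K) `|h x|%:E <=
      \int[leb]_(x in K) `|(g_ k x - g x) * f x|%:E)%E.
    apply: (@ae_ge0_le_integral _ _ _ lebesgue_rV _ mK).
    - by move=> x _; rewrite lee_fin.
    - exact: measurable_EFin_norm.
    - by move=> x _; rewrite lee_fin.
    - exact: measurable_EFin_norm (measurable_funM (measurable_funB (mg_ k) mg) mfK).
    - apply: filterS (g_M k) => x gx Kx; rewrite lee_fin !normrM ler_wpM2r//.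
      exact: clip_dist_le (gx (KU _ Kx)).
  have h0 : (\int[leb]_(x in K) `|h x|%:E = 0)%E.
    apply/eqP; rewrite eq_le integral_ge0 ?andbT//.
    rewrite -(cvg_lim _ cvgf)//; apply: lime_ge; first by apply/cvg_ex; exists 0%E.
    exact: nearW.
  have /(ae_eq_integral_abs lebesgue_rV mK) : measurable_fun K (EFin \o h).
    exact/measurable_EFinP.
  move=> /iffLR /(_ h0); apply: filterS => x hx Kx fx.
  have [/eqP] := hx Kx; rewrite mulf_eq0 (gt_eqF fx) orbF subr_eq0.
  by move=> /eqP.
have cvgI := cvg_integral_bounded_weight mK f_ge0 mfK iE fE mc_ mc
  (fun k x => clip_norm_le (g_ k x) M0) (fun x => clip_norm_le (g x) M0).
have {}cvgI := cvgI _.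
rewrite reduce// -(cvg_limn_einf_sup (cvgI _)).1.
  apply: le_limn_einf => k; rewrite -reduce//.
    by apply: ereal_sup_ubound; exists phi.
  apply: filterS (g_M k) => x gx Kx _; exact: clip_id (gx (KU _ Kx)).
apply: (@squeeze_cvge _ _ _ _ (cst 0%E) _
  (fun k => \int[leb]_(x in K) `|(g_ k x - g x) * f x|%:E)%E); last 2 first.
- exact: cvg_cst.
- exact: cvgf.
apply: nearW => k; rewrite integral_ge0//=.
apply: (@ge0_le_integral _ _ _ lebesgue_rV _ mK).
- by move=> x _; rewrite lee_fin.
- exact: measurable_EFin_norm (measurable_funM (measurable_funB (mc_ k) mc) mfK).
- exact: measurable_EFin_norm (measurable_funM (measurable_funB (mg_ k) mg) mfK).
- by move=> x _; rewrite lee_fin !normrM ler_wpM2r// clip_lipschitz.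
Qed.
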